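(* Let $A\hookrightarrow(S,O)$ be a reduced plane curve singularity and let $\Lambda(\hat{\mathcal{C}}_A)$ be the lotus of a finite active constellation of crosses $\hat{\mathcal{C}}_A$ adapted to $A$. Let $A_l$ and $A_m$ be two distinct branches of $A$. Decorate the edge of the lotus which is the dual segment of the cross $X_P$, for each point $P$ of the underlying constellation $\mathcal{C}_A$, by the multiplicities $e_P(A_l)$ and $e_P(A_m)$ of the strict transforms of $A_l$ and $A_m$ at $P$. Then the intersection number $(A_l \cdot A_m)_O$ is the sum of the products of multiplicities associated to the same edge: $$(A_l\cdot A_m)_O=\sum_{P\in\mathcal{C}_A}e_P(A_l)\,e_P(A_m).$$
   Context: **Infinitely near points and crosses.** $(S,O)$ is a germ of smooth complex analytic surface. A model is a composition of finitely many blowups of points above $O$. An infinitely near point of $O$ is $O$ or a point of the exceptional divisor of a model, points on two models being identified if the natural bimeromorphic map is a biholomorphism near them; $S^P$ is the minimal model containing $P$, and $E_P$ is the exceptional curve created by blowing up $P$ (also denoting its strict transforms). $P\preceq Q$ means that $Q$ is infinitely near $P$; then there is a morphism $\pi^Q_P:S^Q\to S^P$. A constellation is a set $\mathcal{C}$ of infinitely near points such that $Q\in\mathcal{C}$, $P\preceq Q$ imply $P\in\mathcal{C}$; it is active if one has chosen a subset of active points containing all non-maximal points; the others are inactive. A cross at $P$ is a reduced germ of normal crossings divisor with two branches at $P$. A constellation of crosses $\hat{\mathcal{C}}$ is a constellation $\mathcal{C}$ with a cross $X_P$ on $(S^P,P)$ for each $P\in\mathcal{C}$, such that the germ at $Q$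 of $(\pi^Q_P)^{-1}(X_P)$ is contained in $X_Q$ whenever $P\preceq Q$. $S_{\mathcal{C}}$ is the model obtained by blowing up all active points, and $X_{\hat{\mathcal{C}}}$ is the reduced total transform on $S_{\mathcal{C}}$ of all the crosses. $\hat{\mathcal{C}}_A$ is adapted to $A$ if its underlying constellation $\mathcal{C}_A$ is the set of infinitely near points lying on the strict transforms of $A$ on the models between $S$ and an embedded resolution $\pi$ of $A$ (a model on which the total transform of $A$ has normal crossings), with exactly the maximal points declared inactive, and $\pi^{-1}(A)\subseteq X_{\hat{\mathcal{C}}_A}$. **Lotus.** The dual segment of a cross is a segment with vertices labeled by its two branches. The lotus $\Lambda(\hat{\mathcal{C}})$ is the simplicial complex built by starting from the dual segment of $X_O=L+L_1$ and going through the points of $\mathcal{C}$ in an order compatible with $\preceq$: (A) when $P$ is active, glue a triangle (petal) with vertices the branches of $X_P$ and $E_P$ along the dual segment of $X_P$, identifying vertices with the same label; (B) for a point $Q\neq O$, if the germ at $Q$ of the current total transform is a cross, this is $X_Q$, whose dual segment is already present; otherwise $X_Q=E+L_Q$ with $E$ the germ of the exceptional divisor and $L_Q$ smooth transversal to it, and one glues the dual segment of $X_Q$ at the vertex $E$. **Multiplicity, intersection number.** $e_P(B)$ is the multiplicity at $P$ of the strict transform of $B$ on $S^P$ (zero if this strict transform does not pass through $P$). $(A_l\cdot A_m)_O=\dim_{\mathbb{C}}\mathcal{O}_{S,O}/(f_{A_l},f_{A_m})$ for defining functions $f_{A_l},f_{A_m}$. *)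

(* Defs.v *)
From HB Require Import structures.
From mathcomp Require Import all_boot all_order all_algebra finmap.
From mathcomp Require Import boolp classical_sets fsbigop reals.
From mathcomp.real_closed Require Import complex.
From mathcomp Require Import ring.

Set Implicit Arguments.
Unset Strict Implicit.
Unset Printing Implicit Defensive.

Import Order.TTheory GRing.Theory Num.Theory.
Local Open Scope ring_scope.

Record fps (A : comNzRingType) := Fps { coef_fps :> nat -> A }.

HB.instance Definition _ (A : comNzRingType) := gen_eqMixin (fps A).
HB.instance Definition _ (A : comNzRingType) := gen_choiceMixin (fps A).

Section FpsRing.
Variable A : comNzRingType.
Implicit Types f g h : fps A.

Lemma fpsP f g : (forall i, f i = g i) -> f = g.
Proof. by case: f g => [f] [g] /= /funext ->. Qed.

Definition fps_add f g := Fps (fun n => f n + g n).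
Definition fps_opp f := Fps (fun n => - f n).
Definition fps_const (c : A) := Fps (fun n => if n == 0%N then c else 0).
Definition fps_mul f g := Fps (fun n => \sum_(i < n.+1) f i * g (n - i)%N).

Fact fps_addA : associative fps_add.
Proof. by move=> f g h; apply: fpsP => i /=; rewrite addrA. Qed.
Fact fps_addC : commutative fps_add.
Proof. by move=> f g; apply: fpsP => i /=; rewrite addrC. Qed.
Fact fps_add0 : left_id (fps_const 0) fps_add.
Proof. by move=> f; apply: fpsP => i /=; rewrite if_same add0r. Qed.
Fact fps_addN : left_inverse (fps_const 0) fps_opp fps_add.
Proof. by move=> f; apply: fpsP => i /=; rewrite if_same addNr. Qed.

HB.instance Definition _ :=
  GRing.isZmodule.Build (fps A) fps_addA fps_addC fps_add0 fps_addN.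

Definition fps_trunc n f : {poly A} := \poly_(i < n.+1) f i.

Lemma fps_mulE n f g k : (k <= n)%N ->
  fps_mul f g k = (fps_trunc n f * fps_trunc n g)`_k.
Proof.
move=> kn; rewrite coefM; apply: eq_bigr => i _.
rewrite !coef_poly !ltnS (leq_trans _ kn) ?(leq_trans _ kn) ?leq_subr //.
by rewrite -ltnS.
Qed.

Fact fps_mulC : commutative fps_mul.
Proof.
by move=> f g; apply: fpsP => n; rewrite !(@fps_mulE n) // mulrC.
Qed.
Fact fps_mulA : associative fps_mul.
Proof.
move=> f g h; apply: fpsP => n.
have E a b : forall k, (k <= n)%N -> (fps_trunc n (fps_mul a b))`_k =
    (fps_trunc n a * fps_trunc n b)`_k.
  by move=> k kn; rewrite coef_poly ltnS kn (@fps_mulE n).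
rewrite !(@fps_mulE n) //.
transitivity (fps_trunc n f * (fps_trunc n g * fps_trunc n h))`_n.
  by rewrite !coefM; apply: eq_bigr => i _; rewrite E ?leq_subr.
rewrite mulrA [LHS]coefM [RHS]coefM; apply: eq_bigr => i _.
by rewrite E // -ltnS.
Qed.
Fact fps_mul1 : left_id (fps_const 1) fps_mul.
Proof.
move=> f; apply: fpsP => n /=; rewrite big_ord_recl /= mul1r subn0.
by rewrite big1 ?addr0 // => i _; rewrite mul0r.
Qed.
Fact fps_mulDl : left_distributive fps_mul fps_add.
Proof.
move=> f g h; apply: fpsP => n /=; rewrite -big_split /=.
by apply: eq_bigr => i _; rewrite mulrDl.
Qed.
Fact fps_one_neq0 : fps_const 1 != 0.
Proof.
apply/eqP => /(congr1 (fun f : fps A => f 0%N)) /= /eqP.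
by rewrite oner_eq0.
Qed.

HB.instance Definition _ := GRing.Zmodule_isComNzRing.Build (fps A)
  fps_mulA fps_mulC fps_mul1 fps_mulDl fps_one_neq0.

End FpsRing.

(* In local coordinates (x, y) centred at a point, the ring of germs of
   holomorphic functions on a smooth complex surface is the ring C{x, y} of
   convergent power series; [f i j] is the coefficient of x^i y^j, and
   convergence near the origin is expressed by Cauchy's estimates.            *)

Section Germs.
Variable R : realType.
Local Notation C := (R[i]).
Local Notation fps2 := (fps (fps C)).

Definition convergent (f : fps2) : Prop :=
  exists M K : C, [/\ 0 <= M, 0 <= K &
    forall i j, `|f i j| <= M * K ^+ (i + j)].

Definition convergentb : {pred fps2} := fun f => `[< convergent f >].

Lemma leXn2 (n : nat) : (n.+1%:R <= 2 ^+ n :> C).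
Proof. by rewrite -natrX ler_nat ltn_expl. Qed.

Fact convergent_closed : subring_closed convergentb.
Proof.
split.
- apply/asboolP; exists 1, 1; split=> // i j; rewrite expr1n mulr1.
  by case: i j => [|i] [|j] /=; rewrite ?normr1 ?normr0.
- move=> f g /asboolP[M [K [M0 K0 fM]]] /asboolP[N [L [N0 L0 gN]]].
  apply/asboolP; exists (M + N), (K + L); split; rewrite ?addr_ge0 // => i j.
  rewrite /= (le_trans (ler_normB _ _)) // mulrDl lerD //.
    apply: le_trans (fM i j) _; apply: ler_wpM2l => //.
    by apply: lerXn2r; rewrite ?nnegrE ?addr_ge0 // lerDl.
  apply: le_trans (gN i j) _; apply: ler_wpM2l => //.
  by apply: lerXn2r; rewrite ?nnegrE ?addr_ge0 // lerDr.
- move=> f g /asboolP[M [K [M0 K0 fM]]] /asboolP[N [L [N0 L0 gN]]].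
  apply/asboolP; exists (M * N), (2 * (K + L)).
  have KL0 : 0 <= K + L by rewrite addr_ge0.
  split; rewrite ?mulr_ge0 // => i j.
  have sumE (I : nat) (F : 'I_I -> fps C) : (\sum_(a < I) F a) j =
      \sum_(a < I) F a j.
    by elim/big_rec2: _ => [|a x y _ <-] //=; case: j {gN fM}.
  rewrite /= sumE; apply: le_trans (ler_norm_sum _ _ _) _.
  have B (a : 'I_i.+1) : `|(f a * g (i - a)%N) j| <=
      j.+1%:R * (M * N * (K + L) ^+ (i + j)).
    apply: le_trans (ler_norm_sum _ _ _) _.
    rewrite -[X in X%:R]card_ord -sumr_const mulr_suml; apply: ler_sum => b _.
    rewrite mul1r normrM.
    have -> : (i + j = (a + b) + ((i - a) + (j - b)))%N.
      have := ltn_ord a; have := ltn_ord b; rewrite !ltnS => lb la.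
      by rewrite addnACA !subnKC.
    rewrite exprD mulrACA; apply: ler_pM => //.
      apply: le_trans (fM _ _) _; apply: ler_wpM2l => //.
      by apply: lerXn2r; rewrite ?nnegrE // lerDl.
    apply: le_trans (gN _ _) _; apply: ler_wpM2l => //.
    by apply: lerXn2r; rewrite ?nnegrE // lerDr.
  apply: le_trans (ler_sum _ (fun a _ => B a)) _.
  rewrite sumr_const card_ord -[X in X <= _]mulr_natl exprMn.
  have -> : M * N * (2 ^+ (i + j) * (K + L) ^+ (i + j)) =
      2 ^+ i * (2 ^+ j * (M * N * (K + L) ^+ (i + j))) by rewrite exprD; ring.
  have MN0 : 0 <= M * N * (K + L) ^+ (i + j) by rewrite !mulr_ge0 ?exprn_ge0.
  apply: ler_pM; rewrite ?leXn2 ?ler0n ?mulr_ge0 ?ler0n ?exprn_ge0 //.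
  by rewrite ler_wpM2r ?leXn2.
Qed.

Record germ := Germ { germ_val :> fps2; _ : germ_val \in convergentb }.
HB.instance Definition _ := [isSub for germ_val].
HB.instance Definition _ := [Choice of germ by <:].
HB.instance Definition _ :=
  GRing.SubChoice_isSubComNzRing.Build fps2 convergentb germ convergent_closed.

Definition germ_unit : {pred germ} := fun f => `[< exists g, g * f = 1 >].
Definition germ_inv (f : germ) : germ :=
  if pselect (exists g, g * f = 1) is left h then projT1 (cid h) else f.
Fact germ_mulVx : {in germ_unit, left_inverse 1 germ_inv *%R}.
Proof.
move=> f /asboolP fu; rewrite /germ_inv.
by case: pselect => // h; case: cid.
Qed.
Fact germ_unitPl (f g : germ) : g * f = 1 -> germ_unit f.
Proof. by move=> gf; apply/asboolP; exists g. Qed.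
Fact germ_invr_out : {in [predC germ_unit], germ_inv =1 id}.
Proof.
move=> f; rewrite inE => /asboolPn fu; rewrite /germ_inv.
by case: pselect.
Qed.
HB.instance Definition _ := GRing.ComNzRing_hasMulInverse.Build germ
  germ_mulVx germ_unitPl germ_invr_out.


Definition mk_germ (f : fps2) (cf : convergent f) : germ :=
  @Germ f (asboolT cf).

Fact const_convergent (c : C) : convergent (fps_const (fps_const c)).
Proof.
exists `|c|, 1; split=> // i j; rewrite expr1n mulr1.
by case: i j => [|i] [|j] /=; rewrite ?normr0.
Qed.
Definition germ_const (c : C) : germ := mk_germ (const_convergent c).

Definition monom1_fun (a b : nat) : fps2 :=
  Fps (fun i => Fps (fun j => ((i == a) && (j == b))%:R)).
Fact monom1_convergent a b : convergent (monom1_fun a b).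
Proof.
exists 1, 1; split=> // i j; rewrite expr1n mulr1 /=.
by case: (_ && _); rewrite ?normr1 ?normr0.
Qed.
Definition germ_x : germ := mk_germ (monom1_convergent 1%N 0%N).
Definition germ_y : germ := mk_germ (monom1_convergent 0%N 1%N).

Definition germ_dvd (f g : germ) : Prop := exists h, g = h * f.
Definition germ_assoc (f g : germ) : Prop :=
  exists2 u, u \is a GRing.unit & g = u * f.
Definition germ_irreducible (f : germ) : Prop :=
  f \isn't a GRing.unit /\
  forall g h, f = g * h -> g \is a GRing.unit \/ h \is a GRing.unit.

(* order of vanishing at the origin; the order of the zero germ is set to 0 *)
Definition mult (f : germ) : nat :=
  if pselect (exists n, [exists i : 'I_n.+1, f i (n - i)%N != 0]) is left h
  then ex_minn h else 0%N.

(* (a, b) is a system of local coordinates *)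
Definition local_coordinates (a b : germ) : Prop :=
  [/\ a 0%N 0%N = 0, b 0%N 0%N = 0 &
    a 1%N 0%N * b 0%N 1%N - a 0%N 1%N * b 1%N 0%N != 0].

(* f = 0 is a (not necessarily reduced) normal crossings divisor *)
Definition normal_crossings (f : germ) : Prop :=
  exists a b, local_coordinates a b /\
  exists u k l, u \is a GRing.unit /\ f = u * a ^+ k * b ^+ l.

(* The reduced germ of curve f = 0 is contained in g = 0. *)
Definition curve_le (f g : germ) : Prop :=
  forall p, germ_irreducible p -> germ_dvd p f -> germ_dvd p g.

Definition reduced_curve (f : germ) : Prop :=
  [/\ f != 0, f \isn't a GRing.unit &
    forall h, germ_dvd (h ^+ 2) f -> h \is a GRing.unit].

Definition is_branch (b f : germ) : Prop := germ_irreducible b /\ germ_dvd b f.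

(* The quotient of the local ring by (f, g) has complex dimension n: it admits
   a basis of n elements, the classes of the e i.                             *)
Definition intersection_number (f g : germ) (n : nat) : Prop :=
  exists e : 'I_n -> germ, forall h : germ,
    exists! c : {ffun 'I_n -> C}, exists u v : germ,
      h = \sum_i germ_const (c i) * e i + (u * f + v * g).

(* A point of the exceptional curve of the blowup of a point P with local
   coordinates (x, y) is a tangent direction at P: [Some c] is the line
   y = c x, [None] is the line x = 0. Local coordinates (u, v) at these points
   are given by (x, y) = (u, u (v + c)) and by (x, y) = (u v, v) respectively,
   so that the exceptional curve is u = 0, respectively v = 0.                *)

Definition direction := option C.

Definition exceptional (d : direction) : germ :=
  if d is Some _ then germ_x else germ_y.

(* f o pi, where pi is the blowup morphism in the above coordinates *)
Definition blowup_fun (d : direction) (f : fps2) : fps2 :=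
  if d is Some c then
    Fps (fun m => Fps (fun n =>
      \sum_(j < m.+1) f (m - j)%N j * ('C(j, n)%:R * c ^+ (j - n))))
  else Fps (fun m => Fps (fun n => if (m <= n)%N then f m (n - m)%N else 0)).

Fact blowup_convergent d (f : germ) : convergent (blowup_fun d f).
Proof.
case: f => f /= /asboolP[M [K [M0 K0 fM]]]; case: d => [c|].
  exists M, (1 + 4 * K * (1 + `|c|)).
  have c1 : 1 <= 1 + `|c| by rewrite lerDl.
  have c0 : 0 <= 1 + `|c| by rewrite addr_ge0.
  have K1 : 1 <= 1 + 4 * K * (1 + `|c|) by rewrite lerDl !mulr_ge0.
  split; rewrite ?(le_trans _ K1) // => m n /=.
  apply: le_trans (ler_norm_sum _ _ _) _.
  have B (j : 'I_m.+1) : `|f (m - j)%N j * ('C(j, n)%:R * c ^+ (j - n))| <=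
      M * K ^+ m * (2 ^+ m * (1 + `|c|) ^+ m).
    have jm : (j <= m)%N by rewrite -ltnS.
    rewrite normrM; apply: ler_pM => //.
      by have := fM (m - j)%N j; rewrite subnK.
    rewrite normrM; apply: ler_pM => //.
      rewrite ger0_norm ?ler0n // -natrX ler_nat.
      apply: leq_trans (_ : 2 ^ j <= _)%N; last by rewrite leq_pexp2l.
      have [jn|nj] := ltnP j n; first by rewrite bin_small.
      have jnS : (n < j.+1)%N by [].
      have E := Pascal 1 1 j; rewrite addnn -mul2n muln1 in E.
      by rewrite E (bigD1 (Ordinal jnS)) //= !exp1n !muln1 leq_addr.
    rewrite normrX (@le_trans _ _ ((1 + `|c|) ^+ (j - n))) //.
      by apply: lerXn2r; rewrite ?nnegrE // lerDr.
    by rewrite ler_weXn2l // (leq_trans (leq_subr _ _)).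
  apply: le_trans (ler_sum _ (fun a _ => B a)) _.
  rewrite sumr_const card_ord -[X in X <= _]mulr_natl.
  have P0 : 0 <= M * K ^+ m * (2 ^+ m * (1 + `|c|) ^+ m).
    by rewrite !mulr_ge0 ?exprn_ge0.
  apply: le_trans (ler_wpM2r P0 (leXn2 m)) _.
  have -> : 2 ^+ m * (M * K ^+ m * (2 ^+ m * (1 + `|c|) ^+ m)) =
      M * (4 * K * (1 + `|c|)) ^+ m.
    by rewrite !exprMn (_ : 4 = 2 * 2 :> C) ?exprMn -?natrM //; ring.
  apply: ler_wpM2l => //.
  apply: le_trans (_ : (1 + 4 * K * (1 + `|c|)) ^+ m <= _).
    by apply: lerXn2r; rewrite ?nnegrE ?addr_ge0 ?mulr_ge0 // lerDr.
  by rewrite ler_weXn2l // leq_addr.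
exists M, (1 + K); have K1 : 1 <= 1 + K by rewrite lerDl.
split; rewrite ?addr_ge0 // => m n /=; case: ifP => [mn|_].
  apply: le_trans (fM _ _) _; apply: ler_wpM2l => //; rewrite subnKC //.
  apply: le_trans (_ : (1 + K) ^+ n <= _).
    by apply: lerXn2r; rewrite ?nnegrE ?addr_ge0 // lerDr.
  by rewrite ler_weXn2l // leq_addl.
by rewrite normr0 mulr_ge0 ?exprn_ge0 ?addr_ge0.
Qed.
Definition blowup (d : direction) (f : germ) : germ :=
  mk_germ (blowup_convergent d f).

(* strict transform: f o pi divided by the [mult f]-th power of the equation
   of the exceptional curve, see [strict_stepP] *)
Definition strict_step_fun (d : direction) (e : nat) (f : fps2) : fps2 :=
  if d is Some _ then Fps (fun i => f (i + e)%N)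
  else Fps (fun i => Fps (fun j => f i (j + e)%N)).

Fact strict_step_convergent d e (f : germ) : convergent (strict_step_fun d e f).
Proof.
case: f => f /= /asboolP[M [K [M0 K0 fM]]].
exists (M * K ^+ e), K; split; rewrite ?mulr_ge0 ?exprn_ge0 // => i j.
rewrite -mulrA -exprD; case: d => [c|] /=; apply: le_trans (fM _ _) _.
  by rewrite addnAC addnC.
by rewrite addnA addnC.
Qed.
Definition strict_step (d : direction) (f : germ) : germ :=
  mk_germ (strict_step_convergent d (mult f) (blowup d f)).

Lemma germP (f g : germ) : (forall i j, f i j = g i j) -> f = g.
Proof. by move=> fg; apply: val_inj; apply: fpsP => i; apply: fpsP. Qed.

Lemma fps_sumE (A : comNzRingType) (I : nat) (F : 'I_I -> fps A) j :
  (\sum_(a < I) F a) j = \sum_(a < I) F a j.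
Proof. by elim/big_rec2: _ => [|a x y _ <-] //=; case: j. Qed.

Lemma germ_mulE (f g : germ) i j :
  (f * g) i j = \sum_(a < i.+1) \sum_(b < j.+1) f a b * g (i - a)%N (j - b)%N.
Proof. by rewrite /= fps_sumE. Qed.

Lemma monom1_mulE a b (f : germ) i j :
  (mk_germ (monom1_convergent a b) * f) i j =
  if (a <= i)%N && (b <= j)%N then f (i - a)%N (j - b)%N else 0.
Proof.
rewrite germ_mulE; case: ifP => [/andP[ai bj]|ab].
  rewrite -ltnS in ai; rewrite -ltnS in bj.
  rewrite (bigD1 (Ordinal ai)) //= (bigD1 (Ordinal bj)) //= !eqxx mul1r.
  rewrite big1 ?addr0 => [|l /negPf lb]; last first.
    by rewrite [_ == b]lb andbF mul0r.
  rewrite big1 ?addr0 // => k /negPf ka.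
  by rewrite big1 // => l _; rewrite [_ == a]ka mul0r.
apply: big1 => k _; apply: big1 => l _ /=.
case: andP => [[/eqP ka /eqP lb]|_]; last by rewrite mul0r.
by move: ab; rewrite -ka -lb -(ltnS k) -(ltnS l) !ltn_ord.
Qed.

Lemma mult_min (f : germ) a b : (a + b < mult f)%N -> f a b = 0.
Proof.
rewrite /mult; case: pselect => // h; case: ex_minnP => n _ nmin abn.
apply/eqP/negPn/negP => fab; have := abn; rewrite ltnNge => /negP; apply.
apply: nmin; have ab : (a < (a + b).+1)%N by rewrite ltnS leq_addr.
by apply/existsP; exists (Ordinal ab); rewrite /= addKn.
Qed.

Lemma strict_stepP d (f : germ) :
  blowup d f = exceptional d ^+ mult f * strict_step d f.
Proof.
have mx e (g : germ) i j :
    (germ_x ^+ e * g) i j = if (e <= i)%N then g (i - e)%N j else 0.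
  elim: e i => [|e IH] i; first by rewrite mul1r subn0.
  rewrite exprS -mulrA monom1_mulE andbT subn0; case: i => // i.
  by rewrite IH subSS subn0.
have my e (g : germ) i j :
    (germ_y ^+ e * g) i j = if (e <= j)%N then g i (j - e)%N else 0.
  elim: e j => [|e IH] j; first by rewrite mul1r subn0.
  rewrite exprS -mulrA monom1_mulE /= subn0; case: j => // j.
  by rewrite IH subSS subn0.
apply: germP => i j; case: d => [c|].
  rewrite [exceptional _]/= mx; case: leqP => [ei|ie]; first by rewrite /= subnK.
  rewrite /= big1 // => k _; rewrite mult_min ?mul0r // subnK //.
  by rewrite -ltnS.
rewrite [exceptional _]/= my; case: leqP => [ei|ie]; first by rewrite /= subnK.
by rewrite /=; case: ifP => // ij; rewrite mult_min // subnKC.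
Qed.

(* An infinitely near point P of O is the finite sequence of directions leading
   to it, in the coordinates above: O is [::], the points of the exceptional
   curve E_P are the rcons P d, P precedes Q when P is a prefix of Q, and S^P is
   obtained by blowing up the strict prefixes of P.                           *)
Definition ipoint := seq direction.

(* f o pi, for pi : S^Q -> S^P, as a germ at Q; f is a germ at P *)
Definition pullback (P Q : ipoint) (f : germ) : germ :=
  foldl (fun g d => blowup d g) f (drop (size P) Q).

(* strict transform at Q of the germ f at P *)
Definition strict (P Q : ipoint) (f : germ) : germ :=
  foldl (fun g d => strict_step d g) f (drop (size P) Q).

(* e_P(f) *)
Definition multiplicity (P : ipoint) (f : germ) : nat := mult (strict [::] P f).

Definition sprefix (P Q : ipoint) : bool := prefix P Q && (P != Q).

(* equation at Q of the strict transform of E_P, for sprefix P Q *)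
Definition exceptional_curve (P Q : ipoint) : germ :=
  if drop (size P) Q is d :: s
  then strict (rcons P d) Q (exceptional d) else 1.

Definition constellation (B : {fset ipoint}) : Prop :=
  forall P Q, prefix P Q -> Q \in B -> P \in B.

(* Q is a point of the model obtained by blowing up the points of B *)
Definition on_model (B : {fset ipoint}) (Q : ipoint) : Prop :=
  (forall P, sprefix P Q -> P \in B) /\ Q \notin B.

Definition embedded_resolution (B : {fset ipoint}) (f : germ) : Prop :=
  constellation B /\
  forall Q, on_model B Q -> normal_crossings (pullback [::] Q f).

Definition maximal_in (B : {fset ipoint}) (P : ipoint) : Prop :=
  P \in B /\ forall Q, Q \in B -> prefix P Q -> Q = P.

(* The two branches of the cross at P are given by the equations
   [branch P false] and [branch P true]; only the values of [branch] at the
   points of the constellation are relevant.                                  *)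
Record cross_constellation := CrossConstellation {
  points : {fset ipoint};
  active : {fset ipoint};
  branch : ipoint -> bool -> germ;
  points_constellation : constellation points;
  active_points : {subset active <= points};
  active_non_maximal :
    forall P, P \in points -> ~ maximal_in points P -> P \in active;
  branch_cross :
    forall P, P \in points -> local_coordinates (branch P false) (branch P true);
  branch_total :
    forall P Q, P \in points -> Q \in points -> prefix P Q ->
      curve_le (pullback P Q (branch P false * branch P true))
               (branch Q false * branch Q true) }.

Definition cross (X : cross_constellation) (P : ipoint) : germ :=
  branch X P false * branch X P true.

(* The total transform of f = 0 on the model S_C is contained in the reduced
   total transform of all the crosses: at each point Q of S_C, each branch of
   the former is a branch of the total transform of some cross.               *)
Definition total_transform_le (f : germ) (X : cross_constellation) : Prop :=
  forall Q, on_model (active X) Q ->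
  forall p, is_branch p (pullback [::] Q f) ->
    exists P, [/\ P \in points X, prefix P Q & germ_dvd p (pullback P Q (cross X P))].

(* The models lying between S and the model of B are those of the
   constellations contained in B.                                             *)
Definition adapted (X : cross_constellation) (f : germ) : Prop :=
  (exists2 B : {fset ipoint}, embedded_resolution B f &
    forall Q, Q \in points X <->
      (0 < multiplicity Q f)%N /\
      exists B' : {fset ipoint},
        [/\ constellation B', {subset B' <= B} & on_model B' Q]) /\
  (forall P, P \in points X -> (P \in active X <-> ~ maximal_in (points X) P)) /\
  total_transform_le f X.

(* The vertices of the lotus are labelled by the branches of the crosses, a
   branch being identified with its strict transforms. Each branch is named
   after the place where it appears: [Exc P] is E_P, and [New P b] is the
   branch number b of X_P when it is not contained in the total transform of
   the crosses at the points preceding P (both branches of X_O, and L_P when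
   X_P = E + L_P).                                                            *)
Inductive label := Exc of ipoint | New of ipoint & bool.

Variable X : cross_constellation.

Definition new_branch (P : ipoint) (b : bool) : Prop :=
  forall T, T \in points X -> sprefix T P ->
    ~ germ_dvd (branch X P b) (pullback T P (cross X T)).

Definition has_label (Q : ipoint) (b : bool) (l : label) : Prop :=
  match l with
  | Exc P => sprefix P Q /\ germ_assoc (exceptional_curve P Q) (branch X Q b)
  | New P c =>
      [/\ P \in points X, prefix P Q, new_branch P c &
          germ_assoc (strict P Q (branch X P c)) (branch X Q b)]
  end.

(* A simplex is represented by the set of its vertices. *)
Definition dual_segment (Q : ipoint) : set label :=
  [set l | exists b, has_label Q b l]%classic.

Definition petal (P : ipoint) : set label :=
  (dual_segment P `|` [set Exc P])%classic.

Definition lotus : set (set label) :=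
  [set s | s !=set0 /\
    ((exists2 P, P \in points X & s `<=` dual_segment P) \/
     (exists2 P, P \in active X & s `<=` petal P))]%classic.

Definition dual_edges : set (set label) :=
  (lotus `&` [set dual_segment P | P in [set` points X]])%classic.

Definition decorates (m : set label -> nat) (f : germ) : Prop :=
  forall P, P \in points X -> m (dual_segment P) = multiplicity P f.

End Germs.

(* Main.v *)
(* Noether's formula is proved one blowup pi : O -> O' at a time.  If f is an
   irreducible germ of multiplicity p with strict transform f' at its tangent
   direction and exceptional curve E, then pi induces an injection
   O/(f) -> O'/(f') whose image contains E^p O'/(f').  An injective endomorphism of
   O'/(f') that preserves a subspace of finite codimension has cokernels of the
   same dimension on both, so
     dim O/(f, g) = dim O'/(f', E^q g') = p q + dim O'/(f', g'),
   where q is the multiplicity of g.  Everything rests on Weierstrass division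
   in the ring of convergent series: dividing f' gives the remainders in y of
   degree < p, and E^p times such a remainder comes from O; it also contracts
   any curve germ at a point of E to a curve germ downstairs, which shows that
   an irreducible f has only one tangent direction and an irreducible f'.

   The recursion stops because two distinct branches of A are separated as soon
   as the total transform has normal crossings: there both are coordinate
   curves, and they differ since an equality would descend to O.

   Each edge of the lotus determines its point: the dual segment at a point of
   E_T contains the vertex E_T and one more vertex, which is a smooth curve
   at the previous points and so passes through only one point of E_T. *)
From HB Require Import structures.
Require Import Defs.
From mathcomp Require Import all_boot all_order all_algebra finmap.
From mathcomp Require Import boolp classical_sets fsbigop reals.
From mathcomp.real_closed Require Import complex.
From mathcomp Require Import ring zify.

Set Implicit Arguments.
Unset Strict Implicit.
Unset Printing Implicit Defensive.
Import Order.TTheory GRing.Theory Num.Theory.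
Local Open Scope ring_scope.

(** * Codimension of subspaces *)

Section Subspace.
Variables (F : fieldType) (V : lmodType F).
Implicit Types (G H K : V -> Prop).

Definition subspace H := H 0 /\ forall a u v, H u -> H v -> H (a *: u + v).

Lemma subspaceD H u v : subspace H -> H u -> H v -> H (u + v).
Proof. by case=> _ Hl Hu Hv; rewrite -[u]scale1r; apply: Hl. Qed.

Lemma subspaceZ H a u : subspace H -> H u -> H (a *: u).
Proof. by case=> H0 Hl Hu; rewrite -[_ *: _]addr0; apply: Hl. Qed.

Lemma subspaceB H u v : subspace H -> H u -> H v -> H (u - v).
Proof. by case=> _ Hl Hu Hv; rewrite addrC -scaleN1r; apply: Hl. Qed.

Lemma subspace_sum H n (c : 'I_n -> F) (e : 'I_n -> V) :
  subspace H -> (forall i, H (e i)) -> H (\sum_i c i *: e i).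
Proof.
move=> sH He; elim/big_ind: _ => [|u v|i _]; first by case: sH.
  exact: subspaceD.
exact: subspaceZ.
Qed.

Definition indep_mod K n (e : 'I_n -> V) :=
  forall c : 'I_n -> F, K (\sum_i c i *: e i) -> forall i, c i = 0.

Definition span_mod H K n (e : 'I_n -> V) :=
  forall h, H h -> exists c : 'I_n -> F, K (h - \sum_i c i *: e i).

(** The dimension of the quotient of [H] by [K], expressed by a basis of [H] modulo [K] so that no
    quotient space has to be formed. *)
Definition codim H K n := exists e : 'I_n -> V,
  [/\ forall i, H (e i), indep_mod K e & span_mod H K e].

(** If [m > n], the matrix of coordinates of the [e i] on the [f j] has a nonzero vector in its left
    kernel, which is a linear relation modulo [K]. *)
Lemma indep_le_span H K m n (e : 'I_m -> V) (f : 'I_n -> V) :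
  subspace K -> (forall i, H (e i)) -> indep_mod K e -> span_mod H K f ->
  (m <= n)%N.
Proof.
move=> sK He ie sf.
have [A AP] := choice (fun i => sf _ (He i)).
pose M := \matrix_(i < m, j < n) A i j.
have [fM|] := boolP (row_free M).
  by rewrite -(eqP fM) rank_leq_col.
rewrite -kermx_eq0 => /rowV0Pn[u /sub_kermxP uM u0].
case/negP: u0; apply/eqP/rowP => i; rewrite mxE.
apply: (ie (u 0)); have -> : \sum_i u 0 i *: e i =
    \sum_i u 0 i *: (e i - \sum_j A i j *: f j).
  under [RHS]eq_bigr => k _ do rewrite scalerBr scaler_sumr.
  rewrite sumrB exchange_big /= [X in _ - X]big1 ?subr0 // => j _.
  under eq_bigr => k _ do rewrite scalerA.
  rewrite -scaler_suml; have /rowP/(_ j) := uM; rewrite !mxE => E.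
  rewrite (_ : \sum_k _ = 0) ?scale0r //; apply: etrans E.
  by apply: eq_bigr => k _; rewrite mxE.
exact: subspace_sum.
Qed.

Lemma codim_uniq H K m n : subspace K -> codim H K m -> codim H K n -> m = n.
Proof.
move=> sK [e [He ie se]] [f [Hf if_ sf]]; apply/eqP; rewrite eqn_leq.
by rewrite (indep_le_span sK He ie sf) (indep_le_span sK Hf if_ se).
Qed.

(** A bound on the length of independent families yields one of maximal length, which must span. *)
Lemma codim_exists H K n : subspace K ->
  (forall m (e : 'I_m -> V), (forall i, H (e i)) -> indep_mod K e ->
    (m <= n)%N) ->
  exists m, codim H K m.
Proof.
move=> sK bound.
pose P m := `[< exists e : 'I_m -> V, (forall i, H (e i)) /\ indep_mod K e >].
have P0 : exists m, P m.
  by exists 0%N; apply/asboolP; exists (fun=> 0); split=> [|c _] [].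
have Pn m : P m -> (m <= n)%N by case/asboolP => e []; apply: bound.
case: (ex_maxnP P0 Pn) => m /asboolP[e [He ie]] mmax.
exists m, e; split=> // h Hh; apply: contrapT => nspan.
have /mmax : P m.+1; last by rewrite ltnn.
apply/asboolP; exists (fun i => if unlift ord0 i is Some j then e j else h).
split=> [i|c]; first by case: unliftP.
rewrite big_ord_recl /= unlift_none.
under eq_bigr => i _ do rewrite liftK.
(* A relation where [h] has coefficient zero is one among the [e j]; any other expresses [h] through
   the [e j] modulo [K]. *)
have [c0|c0] := eqVneq (c ord0) 0.
  rewrite c0 scale0r add0r => Kc i; case: (unliftP ord0 i) => [j|] -> //.
  exact: (ie (fun j => c (lift ord0 j))).
move=> Kc; case: nspan; exists (fun j => - (c ord0)^-1 * c (lift ord0 j)).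
have := subspaceZ (c ord0)^-1 sK Kc; rewrite scalerDr scalerA mulVf //.
rewrite scale1r scaler_sumr; congr (K (_ + _)); rewrite -sumrN.
by apply: eq_bigr => j _; rewrite scalerA mulNr scaleNr opprK.
Qed.

Lemma codim_add G H K a b : subspace G -> subspace H -> subspace K ->
  (forall v, K v -> H v) -> (forall v, H v -> G v) ->
  codim G H a -> codim H K b -> codim G K (a + b).
Proof.
move=> sG sH sK KH HG [e [Ge ie se]] [f [Hf if_ sf]].
exists (fun i => match split i with inl j => e j | inr j => f j end).
have spl (c : 'I_(a + b) -> F) :
    \sum_i c i *: (match split i with inl j => e j | inr j => f j end) =
    \sum_i c (lshift b i) *: e i + \sum_i c (rshift a i) *: f i.
  rewrite big_split_ord /=; congr (_ + _); apply: eq_bigr => i _.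
    by rewrite (unsplitK (inl i : 'I_a + 'I_b)).
  by rewrite (unsplitK (inr i : 'I_a + 'I_b)).
split=> [i|c|h Gh].
- by case: split => j; [apply: Ge|apply/HG/Hf].
- rewrite spl => Kc.
  have Hc : H (\sum_i c (rshift a i) *: f i) by apply: subspace_sum.
  have ce := ie (fun i => c (lshift b i)).
  have {}ce i : c (lshift b i) = 0.
    apply: ce; rewrite -[X in H X](addrK (\sum_i c (rshift a i) *: f i)).
    by apply: subspaceB => //; apply: KH.
  have cf i : c (rshift a i) = 0.
    move: Kc; rewrite big1 ?add0r => [Kc|j _]; last by rewrite ce scale0r.
    exact: (if_ (fun i => c (rshift a i))).
  by move=> i; rewrite -(splitK i); case: split.
- have [c Hc] := se _ Gh; have [k Kk] := sf _ Hc.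
  exists (fun i => match split i with inl j => c j | inr j => k j end).
  rewrite spl; under eq_bigr => i _ do rewrite (unsplitK (inl i : 'I_a + 'I_b)).
  under [X in _ - (_ + X)]eq_bigr => i _ do rewrite (unsplitK (inr i : 'I_a + 'I_b)).
  by rewrite opprD addrA.
Qed.

Lemma codim_bigger G H K n : subspace H -> subspace K ->
  (forall v, K v -> H v) -> codim G K n -> exists m, codim G H m.
Proof.
move=> sH sK KH [e [Ge ie se]]; apply: (@codim_exists _ _ n) => // m f Gf if_.
by apply: (indep_le_span sK Gf _ se) => c /KH; apply: if_.
Qed.

(** The bound [a + b] makes the codimension of [K] in [H] finite; additivity and uniqueness then let
    [a] cancel. *)
Lemma codim_sub G H K a b : subspace G -> subspace H -> subspace K ->
  (forall v, K v -> H v) -> (forall v, H v -> G v) ->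
  codim G H a -> codim G K (a + b) -> codim H K b.
Proof.
move=> sG sH sK KH HG GH GK.
have [m HK] : exists m, codim H K m.
  have [e [Ge ie se]] := GK; apply: (@codim_exists _ _ (a + b)) => // m f Hf if_.
  by apply: (indep_le_span sK _ if_ se) => i; apply: HG.
have := codim_uniq sK (codim_add sG sH sK KH HG GH HK) GK.
by move/addnI => <-.
Qed.

End Subspace.

(** * Codimension under linear maps *)

Section Transport.
Variables (F : fieldType) (V W : lmodType F) (phi : V -> W).
Variables (H K : V -> Prop) (H' K' : W -> Prop).
Hypothesis phiL : forall a u v, phi (a *: u + v) = a *: phi u + phi v.
Hypothesis sH : subspace H.
Hypothesis sK' : subspace K'.
Hypothesis HH' : forall h, H h -> H' (phi h).
Hypothesis KK' : forall h, H h -> (K' (phi h) <-> K h).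
Hypothesis surj : forall h', H' h' -> exists2 h, H h & K' (h' - phi h).

Let phi0 : phi 0 = 0.
Proof. by have := phiL (-1) 0 0; rewrite scaleN1r oppr0 addr0 scaleN1r addNr. Qed.

Let phi_sum n (c : 'I_n -> F) e : phi (\sum_i c i *: e i) = \sum_i c i *: phi (e i).
Proof.
elim/big_rec2: _ => [|i y1 y2 _ <-]; [exact: phi0 | exact: phiL].
Qed.

Let phiB u v : phi (u - v) = phi u - phi v.
Proof. by rewrite addrC -scaleN1r phiL scaleN1r addrC. Qed.

(** The section hypotheses say that [phi] induces an isomorphism from [H] modulo [K] onto [H']
    modulo [K'], so it carries bases to bases. *)
Lemma codim_image n : codim H K n -> codim H' K' n.
Proof.
move=> [e [He ie se]]; exists (phi \o e); split=> [i|c|h' Hh'] /=.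
- exact: HH'.
- have Hc : H (\sum_i c i *: e i) by apply: subspace_sum.
  by rewrite -phi_sum => /(KK' Hc); apply: ie.
- have [h Hh K'h] := surj Hh'; have [c Kc] := se _ Hh; exists c.
  rewrite -phi_sum -(subrKA (phi h)); apply: subspaceD => //.
  have Hc : H (h - \sum_i c i *: e i) by apply: subspaceB => //; apply: subspace_sum.
  by rewrite -phiB; apply/(KK' Hc).
Qed.

Lemma codim_preimage n : codim H' K' n -> codim H K n.
Proof.
move=> [e' [He' ie' se']].
have lift i : exists h, H h /\ K' (e' i - phi h).
  by have [h ? ?] := surj (He' i); exists h.
have [e eP] := choice lift.
have He i : H (e i) by case: (eP i).
have dif (c : 'I_n -> F) :
    K' (\sum_i c i *: e' i - \sum_i c i *: phi (e i)).
  rewrite -sumrB; under eq_bigr => i _ do rewrite -scalerBr.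
  by apply: subspace_sum => // i; case: (eP i).
exists e; split=> // [c Kc|h Hh].
- apply: ie'; rewrite -[X in K' X](subrK (\sum_i c i *: phi (e i))).
  have Hc : H (\sum_i c i *: e i) by apply: subspace_sum.
  by apply: subspaceD => //; rewrite -phi_sum; apply/(KK' Hc).
- have [c Kc] := se' _ (HH' Hh); exists c.
  have Hc : H (h - \sum_i c i *: e i) by apply: subspaceB => //; apply: subspace_sum.
  apply/(KK' Hc).
  rewrite phiB phi_sum -(subrKA (\sum_i c i *: e' i)).
  exact: subspaceD.
Qed.

End Transport.

(** * Coefficients and multiplicity of germs *)

Section GermBasics.
Variable R : realType.
Local Notation C := (R[i]).
Local Notation germ := (germ R).
Implicit Types (f g h : germ).

(* Rewriting under the two nested projections of [f i j] makes unification
   diverge, hence a dedicated coefficient function. *)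
Definition cf f (i j : nat) : C := f i j.

Lemma cfP f g : (forall i j, cf f i j = cf g i j) -> f = g.
Proof. exact: germP. Qed.

Lemma cf_mulE f g i j : cf (f * g) i j =
  \sum_(a < i.+1) \sum_(b < j.+1) cf f a b * cf g (i - a)%N (j - b)%N.
Proof. exact: germ_mulE. Qed.

Lemma germDE f g i j : cf (f + g) i j = cf f i j + cf g i j. Proof. by []. Qed.
Lemma germNE f i j : cf (- f) i j = - cf f i j. Proof. by []. Qed.
Lemma germ0E i j : cf (0 : germ) i j = 0. Proof. by case: i j => [|i] [|j]. Qed.
Lemma germ1E i j : cf (1 : germ) i j = ((i == 0%N) && (j == 0%N))%:R.
Proof. by case: i j => [|i] [|j]. Qed.
Lemma germ_sumE n (F : 'I_n -> germ) i j : cf (\sum_k F k) i j = \sum_k cf (F k) i j.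
Proof.
by elim/big_rec2: _ => [|k x y _ <-]; [rewrite germ0E | rewrite germDE].
Qed.

Lemma germ_const_mulE (c : C) f i j : cf (germ_const c * f) i j = c * cf f i j.
Proof.
rewrite cf_mulE big_ord_recl big_ord_recl /= !subn0.
rewrite big1 ?addr0 => [|k _]; last by rewrite mul0r.
rewrite big1 ?addr0 // => k _; rewrite big1 // => l _.
by rewrite /= /bump /=; case: (nat_of_ord l) => [|?] /=; rewrite mul0r.
Qed.

Fact germ_scaleA (a b : C) f :
  germ_const a * (germ_const b * f) = germ_const (a * b) * f.
Proof. by apply: cfP => i j; rewrite !germ_const_mulE mulrA. Qed.
Fact germ_scale1 : left_id 1 (fun (a : C) f => germ_const a * f).
Proof. by move=> f; apply: cfP => i j; rewrite germ_const_mulE mul1r. Qed.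
Fact germ_scaleDr : right_distributive (fun (a : C) f => germ_const a * f) +%R.
Proof. by move=> a f g; rewrite mulrDr. Qed.
Fact germ_scaleDl f :
  {morph (fun a : C => germ_const a * f) : a b / a + b}.
Proof.
by move=> a b; apply: cfP => i j; rewrite germDE !germ_const_mulE mulrDl.
Qed.

HB.instance Definition _ := GRing.Zmodule_isLmodule.Build C germ
  germ_scaleA germ_scale1 germ_scaleDr germ_scaleDl.

Lemma germ_scaleE (a : C) f : a *: f = germ_const a * f. Proof. by []. Qed.
Lemma germ_scalecE (a : C) f i j : cf (a *: f) i j = a * cf f i j.
Proof. exact: germ_const_mulE. Qed.

Lemma cf_xM f i j : cf (germ_x R * f) i j = if i is k.+1 then cf f k j else 0.
Proof.
by rewrite /cf /germ_x monom1_mulE subn0 andbT; case: i => // i; rewrite subn1.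
Qed.

Lemma cf_yM f i j : cf (germ_y R * f) i j = if j is k.+1 then cf f i k else 0.
Proof.
by rewrite /cf /germ_y monom1_mulE subn0 /=; case: j => // j; rewrite subn1.
Qed.

Lemma xnE e f i j :
  cf (germ_x R ^+ e * f) i j = if (e <= i)%N then cf f (i - e)%N j else 0.
Proof.
elim: e i => [|e IH] i; first by rewrite mul1r subn0.
by rewrite exprS -mulrA cf_xM; case: i => // i; rewrite IH subSS.
Qed.

Lemma ynE e f i j :
  cf (germ_y R ^+ e * f) i j = if (e <= j)%N then cf f i (j - e)%N else 0.
Proof.
elim: e j => [|e IH] j; first by rewrite mul1r subn0.
by rewrite exprS -mulrA cf_yM; case: j => // j; rewrite IH subSS.
Qed.

(** Exchanging the coordinates turns the direction [None] into [Some 0], so that arguments in the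
    chart [None] reduce to a chart [Some c]. *)
Definition swap_fun (f : fps (fps C)) : fps (fps C) :=
  Fps (fun i => Fps (fun j => f j i)).

Fact swap_convergent f : convergent (swap_fun f).
Proof.
case: f => f /= /asboolP[M [K [M0 K0 fM]]]; exists M, K; split=> // i j.
by rewrite addnC; apply: fM.
Qed.

Definition swap f : germ := mk_germ (swap_convergent f).

Lemma swapK : involutive swap. Proof. by move=> f; apply: cfP. Qed.
Lemma swapD : {morph swap : f g / f + g}.
Proof. by move=> f g; apply: cfP. Qed.
Lemma swapM : {morph swap : f g / f * g}.
Proof.
move=> f g; apply: cfP => i j.
by rewrite [LHS]cf_mulE [RHS]cf_mulE exchange_big.
Qed.
Lemma swapN : {morph swap : f / - f}.
Proof. by move=> f; apply: cfP. Qed.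
Lemma swap0 : swap 0 = 0.
Proof. by apply: cfP => i j; rewrite [LHS]germ0E germ0E. Qed.
Lemma swap1 : swap 1 = 1.
Proof. by apply: cfP => i j; rewrite [LHS]germ1E germ1E andbC. Qed.
Lemma swapZ (a : C) f : swap (a *: f) = a *: swap f.
Proof. by apply: cfP => i j; rewrite [LHS]germ_scalecE germ_scalecE. Qed.
Lemma swapX n : {morph swap : f / f ^+ n}.
Proof. by move=> f; elim: n => [|n IH]; rewrite ?swap1 // !exprS swapM IH. Qed.
Lemma swap_x : swap (germ_x R) = germ_y R.
Proof. by apply: cfP => i j; rewrite /cf /= andbC. Qed.
Lemma swap_y : swap (germ_y R) = germ_x R.
Proof. by rewrite -swap_x swapK. Qed.
Lemma swap_inj : injective swap. Proof. exact: inv_inj swapK. Qed.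

(* The homogeneous component of degree m, as a polynomial in y / x. *)
Definition hform m f : {poly C} := \poly_(j < m.+1) cf f (m - j)%N j.

Lemma coef_hform m f j : (hform m f)`_j = if (j <= m)%N then cf f (m - j)%N j else 0.
Proof. by rewrite coef_poly ltnS. Qed.

Lemma sum_shift (A : zmodType) (F : nat -> A) b k m : (b + k <= m)%N ->
  \sum_(a < m.+1) (if (b <= a <= b + k)%N then F (a - b)%N else 0) =
  \sum_(a < k.+1) F a.
Proof.
move=> bkm; rewrite -(big_mkord xpredT
  (fun a => if (b <= a <= b + k)%N then F (a - b)%N else 0)).
rewrite (@big_cat_nat _ _ _ b) //=; last by lia.
rewrite [X in X + _]big_nat_cond [X in X + _]big1 ?add0r; last first.
  by move=> a; case: ifP => // ? ?; lia.
rewrite (@big_cat_nat _ _ _ (b + k).+1) //=; last by lia.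
rewrite [X in _ + X]big_nat_cond [X in _ + X]big1 ?addr0; last first.
  by move=> a; case: ifP => // ? ?; lia.
rewrite -{1}[b]add0n big_addn (_ : (b + k).+1 - b = k.+1)%N; last by lia.
rewrite big_mkord; apply: eq_bigr => a _; rewrite addnK.
by have := ltn_ord a; rewrite ltnS => ak; rewrite leq_addl addnC leq_add2l ak.
Qed.

(** Monomials are grouped by degree: once the exponent [b] of y in the factor from [f] is fixed, the
    degree [a] of that factor runs from [b] to [b + (m - j)], the window of [sum_shift]. *)
Lemma hform_mul m f g : hform m (f * g) = \sum_(a < m.+1) hform a f * hform (m - a)%N g.
Proof.
apply/polyP => j; rewrite coef_hform coef_sum.
under [RHS]eq_bigr => a _ do rewrite coefM.
rewrite exchange_big /=; case: leqP => [jm|mj]; last first.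
  rewrite big1 // => b _; rewrite big1 // => a _; rewrite !coef_hform.
  have := ltn_ord a; have := ltn_ord b => bj am.
  by case: leqP; rewrite ?mul0r // => ba; case: leqP; rewrite ?mulr0 // => ?; lia.
rewrite cf_mulE exchange_big /=; apply: eq_bigr => b _.
have := ltn_ord b; rewrite ltnS => bj.
rewrite -(sum_shift (fun a => cf f a b * cf g (m - j - a)%N (j - b)%N) (b := b) (m := m)); last lia.
apply: eq_bigr => a _; rewrite !coef_hform; have := ltn_ord a; rewrite ltnS => am.
case: (leqP b a) => ba /=; last by rewrite mul0r.
rewrite (_ : (a <= b + (m - j))%N = (j - b <= m - a)%N); last by lia.
case: leqP => jb; last by rewrite mulr0.
by congr (_ * g _ _); lia.
Qed.

Lemma hformD m f g : hform m (f + g) = hform m f + hform m g.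
Proof.
by apply/polyP => j; rewrite coefD !coef_hform; case: ifP; rewrite ?addr0.
Qed.

Lemma hform_inj f g : (forall m, hform m f = hform m g) -> f = g.
Proof.
move=> fg; apply: cfP => i j; have /polyP/(_ j) := fg (i + j)%N.
by rewrite !coef_hform leq_addl addnK.
Qed.

Lemma cf_mult_min f a b : (a + b < mult f)%N -> cf f a b = 0.
Proof. exact: mult_min. Qed.

Lemma mult_form_lt f m : (m < mult f)%N -> hform m f = 0.
Proof.
move=> mf; apply/polyP => j; rewrite coef_hform coef0; case: ifP => // jm.
by rewrite cf_mult_min // subnK.
Qed.

Lemma mult_eq f n : (forall m, (m < n)%N -> hform m f = 0) -> hform n f != 0 ->
  mult f = n.
Proof.
move=> f0 fn; rewrite /mult; case: pselect => [h|nh].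
  case: ex_minnP => k /existsP[i fi] kmin; apply/eqP; rewrite eqn_leq; apply/andP; split.
    apply: kmin; apply: contraR fn; rewrite negb_exists => /forallP nf.
    apply/eqP/polyP => j; rewrite coef_hform coef0; case: ifP => // jn.
    have nj : (n - j < n.+1)%N by rewrite ltnS leq_subr.
    by have := nf (Ordinal nj); rewrite negbK /= subKn // => /eqP.
  rewrite leqNgt; apply: contra fi => /f0/polyP/(_ (k - i)%N).
  have := ltn_ord i; rewrite ltnS => ik.
  by rewrite coef_hform coef0 leq_subr subKn // => E; apply/eqP.
case: nh; exists n; apply: contraR fn; rewrite negb_exists => /forallP nf.
apply/eqP/polyP => j; rewrite coef_hform coef0; case: ifP => // jn.
have nj : (n - j < n.+1)%N by rewrite ltnS leq_subr.
by have := nf (Ordinal nj); rewrite negbK /= subKn // => /eqP.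
Qed.

Lemma mult_form_neq0 f : f != 0 -> hform (mult f) f != 0.
Proof.
move=> f0; have [m] : exists m, hform m f != 0.
  apply: contrapT => nf; case/negP: f0; apply/eqP/hform_inj => m.
  rewrite [RHS](_ : _ = 0); last first.
    by apply/polyP => j; rewrite coef_hform coef0 germ0E if_same.
  by apply/eqP/negPn/negP => fm; apply: nf; exists m.
move=> fm; have [k fk kmin] := @ex_minnP (fun m => hform m f != 0) (ex_intro _ m fm).
rewrite (@mult_eq f k) // => l lk; apply/eqP/negPn/negP => /kmin.
by rewrite leqNgt lk.
Qed.

Lemma form_mul_mult f g :
  hform (mult f + mult g) (f * g) = hform (mult f) f * hform (mult g) g.
Proof.
have mf : (mult f < (mult f + mult g).+1)%N by rewrite ltnS leq_addr.
rewrite hform_mul (bigD1 (Ordinal mf)) //= addKn big1 ?addr0 // => a.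
rewrite -val_eqE /= => am; have [af|fa] := ltnP a (mult f).
  by rewrite mult_form_lt ?mul0r.
by rewrite [hform (_ - _)%N _]mult_form_lt ?mulr0 //; have := ltn_ord a; lia.
Qed.

Lemma multM f g : f != 0 -> g != 0 -> mult (f * g) = (mult f + mult g)%N.
Proof.
move=> f0 g0; apply: mult_eq => [m mfg|]; last first.
  by rewrite form_mul_mult mulf_neq0 ?mult_form_neq0.
rewrite hform_mul big1 // => a _; have [af|fa] := ltnP a (mult f).
  by rewrite mult_form_lt ?mul0r.
by rewrite [hform (_ - _)%N _]mult_form_lt ?mulr0 //; have := ltn_ord a; lia.
Qed.

(** Leading forms multiply, and polynomials over a field have no zero divisors. *)
Lemma germ_mulf_neq0 f g : f != 0 -> g != 0 -> f * g != 0.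
Proof.
move=> f0 g0; apply/eqP => fg0; have := form_mul_mult f g.
rewrite fg0 => /polyP E; have := mulf_neq0 (mult_form_neq0 f0) (mult_form_neq0 g0).
by case/eqP; apply/polyP => j; rewrite -E coef_hform germ0E if_same coef0.
Qed.

Lemma germ_mulfI f : f != 0 -> injective ( *%R f).
Proof.
move=> f0 g h fgh; apply/eqP; rewrite -subr_eq0; apply: contraTT isT => gh.
by have := germ_mulf_neq0 f0 gh; rewrite mulrBr fgh subrr eqxx.
Qed.

Lemma swap_form m f : hform m (swap f) = \poly_(j < m.+1) (hform m f)`_(m - j).
Proof.
apply/polyP => j; rewrite coef_hform coef_poly ltnS; case: ifP => // jm.
by rewrite coef_hform leq_subr subKn.
Qed.

Lemma mult_swap f : mult (swap f) = mult f.
Proof.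
have [->|f0] := eqVneq f 0; first by rewrite swap0.
apply: mult_eq => [m mf|].
  rewrite swap_form mult_form_lt //; apply/polyP => j.
  by rewrite coef_poly !coef0 if_same.
apply: contra (mult_form_neq0 f0) => /eqP/polyP E; apply/eqP/polyP => j.
have := E (mult f - j)%N; rewrite swap_form coef_poly ltnS leq_subr !coef0.
rewrite [X in _ -> X = _]coef_hform; case: leqP => // jf.
by rewrite subKn // => <-; rewrite coef_hform jf.
Qed.

Lemma const_eq0 f : (0 < mult f)%N -> cf f 0%N 0%N = 0.
Proof. by move=> m; rewrite cf_mult_min. Qed.

Lemma mult_gt0 f : f != 0 -> (0 < mult f)%N = (cf f 0%N 0%N == 0).
Proof.
move=> f0; apply/idP/eqP => [/const_eq0//|f00].
rewrite lt0n; apply: contra (mult_form_neq0 f0) => /eqP ->.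
apply/eqP/polyP => j; rewrite coef_hform coef0 leqn0; case: eqP => // ->.
by rewrite subn0.
Qed.

End GermBasics.

(** * Weierstrass division for convergent series *)

Section Weierstrass.
Variable R : realType.
Local Notation C := (R[i]).
Local Notation germ := (germ R).
Implicit Types (f g h k q : germ).

Lemma cf_bound f : exists M K : C, [/\ 0 <= M, 0 <= K &
  forall i j, `|cf f i j| <= M * K ^+ (i + j)].
Proof. by case: f => f fc; have /asboolP := fc. Qed.

Fact ydrop_convergent r f :
  convergent (Fps (fun i => Fps (fun j => cf f i (j + r)%N))).
Proof.
have [M [K [M0 K0 fM]]] := cf_bound f.
exists (M * K ^+ r), K; split; rewrite ?mulr_ge0 ?exprn_ge0 // => i j.
rewrite -mulrA -exprD; apply: le_trans (fM _ _) _.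
by rewrite addnA addnC.
Qed.
Definition ydrop r f : germ := mk_germ (ydrop_convergent r f).

Fact ytake_convergent r f :
  convergent (Fps (fun i => Fps (fun j => if (j < r)%N then cf f i j else 0))).
Proof.
have [M [K [M0 K0 fM]]] := cf_bound f; exists M, K; split=> // i j /=.
by case: ifP => _; [apply: fM | rewrite normr0 mulr_ge0 ?exprn_ge0].
Qed.
Definition ytake r f : germ := mk_germ (ytake_convergent r f).

Lemma cf_ydrop r f i j : cf (ydrop r f) i j = cf f i (j + r)%N.
Proof. by []. Qed.
Lemma cf_ytake r f i j : cf (ytake r f) i j = if (j < r)%N then cf f i j else 0.
Proof. by []. Qed.

Lemma ydrop_take r f : f = germ_y R ^+ r * ydrop r f + ytake r f.
Proof.
apply: cfP => i j; rewrite germDE ynE cf_ydrop cf_ytake.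
by case: leqP => [rj|jr]; rewrite ?subnK ?addr0 ?add0r.
Qed.

Definition xdrop r f := swap (ydrop r (swap f)).

Lemma cf_xdrop r f i j : cf (xdrop r f) i j = cf f (i + r)%N j.
Proof. by []. Qed.

Lemma xdrop_divides r f : (forall i j, (i < r)%N -> cf f i j = 0) ->
  f = germ_x R ^+ r * xdrop r f.
Proof.
move=> f0; apply: cfP => i j; rewrite xnE cf_xdrop.
by case: leqP => [ri|ir]; [rewrite subnK | rewrite f0].
Qed.

Lemma xdrop1_divides f : (forall j, cf f 0 j = 0) -> f = germ_x R * xdrop 1 f.
Proof. by move=> f0; apply: (@xdrop_divides 1) => -[]. Qed.

(** A geometric sum of ratio [K / L], at most 1/2, is at most twice its first term. *)
Lemma geometric_sum_le (K L : C) n : 0 <= K -> 2 * K <= L ->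
  \sum_(b < n.+1) K ^+ b * L ^+ (n - b) <= 2 * L ^+ n.
Proof.
move=> K0 KL; have L0 : 0 <= L by apply: le_trans KL; rewrite mulr_ge0.
elim: n => [|n IH]; first by rewrite big_ord1 mul1r ler_peMl ?ler1n.
rewrite big_ord_recl /= mul1r subn0.
under eq_bigr => i _ do rewrite /bump /= add1n subSS exprS -mulrA.
rewrite -mulr_sumr; apply: (@le_trans _ _ (L ^+ n.+1 + K * (2 * L ^+ n))).
  by rewrite lerD2l ler_wpM2l.
rewrite mulrCA mulrA [2 * L ^+ n.+1]mulr_natl mulr2n lerD2l exprS.
by rewrite ler_wpM2r ?exprn_ge0.
Qed.

Section FixedPoint.
Variables (r : nat) (k h : germ).

(** The right-hand side of T = h + x k ([ydrop r T]), on coefficients. Because of the factor x, row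
    [i] depends only on earlier rows, so the iterates from 0 stabilize row by row. *)
Let step (T : nat -> nat -> C) i j := cf h i j +
  if i is l.+1 then
    \sum_(a < l.+1) \sum_(b < j.+1) cf k a b * T (l - a)%N (j - b + r)%N
  else 0.

Let approx n := iter n step (fun _ _ => 0).

Let approx_stable n m i j : (i < n)%N -> (i < m)%N -> approx n i j = approx m i j.
Proof.
elim: n m i j => [|n IH] [|m] [|i] j //; rewrite !ltnS => ni mi; rewrite /= /step.
congr (_ + _); apply: eq_bigr => a _; apply: eq_bigr => b _; congr (_ * _).
by apply: IH; apply: leq_ltn_trans (leq_subr _ _) _.
Qed.

Let limit i j := approx i.+1 i j.

Let limitE i j : limit i j = step limit i j.
Proof.
rewrite -[LHS]/(step (approx i) i j) /step; case: i => [//|i]; congr (_ + _).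
apply: eq_bigr => a _; apply: eq_bigr => b _; congr (_ * _).
by rewrite /limit; apply: approx_stable; rewrite ltnS // leq_subr.
Qed.

(** The estimate has separate rates [A] in x and [L] in y: the shift by [r] costs a factor [L ^+ r]
    for each power of x gained, and a large [A] pays for it. *)
Let limit_convergent : convergent (Fps (fun i => Fps (limit i))).
Proof.
have [M [K0 [M0 K00 hM]]] := cf_bound h.
have [N [K1 [N0 K10 kN]]] := cf_bound k.
pose K := K0 + K1; have Kge0 : 0 <= K by rewrite addr_ge0.
pose L := 2 * K; have L0 : 0 <= L by rewrite mulr_ge0.
(* The second term of A absorbs the two geometric sums and the shift by r. *)
pose A := 2 * K + 8 * N * L ^+ r.
have LA : L <= A by rewrite lerDl !mulr_ge0 ?exprn_ge0.
have A0 : 0 <= A := le_trans L0 LA.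
have KL : K <= L by rewrite /L mulr_natl mulr2n lerDl.
have KA : K <= A := le_trans KL LA.
have h_le i j : `|cf h i j| <= M * (A ^+ i * L ^+ j).
  apply: le_trans (hM i j) _; apply: ler_wpM2l => //; rewrite exprD.
  have K0K : K0 <= K by rewrite lerDl.
  by apply: ler_pM; rewrite ?exprn_ge0 //; apply: lerXn2r;
    rewrite ?nnegrE //; apply: le_trans K0K _.
have k_le i j : `|cf k i j| <= N * (K ^+ i * K ^+ j).
  apply: le_trans (kN i j) _; apply: ler_wpM2l => //; rewrite -exprD.
  by apply: lerXn2r; rewrite ?nnegrE // lerDr.
(* One half of the constant [2 * M] absorbs [h], the other half the double sum; the bound is uniform
   in [n], so it holds for the limit. *)
have bnd n i j : `|approx n i j| <= 2 * M * (A ^+ i * L ^+ j).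
  elim: n i j => [|n IH] i j; first by rewrite normr0 !mulr_ge0 ?exprn_ge0.
  rewrite /= /step; apply: le_trans (ler_normD _ _) _.
  rewrite -mulrA mulr_natl mulr2n; apply: lerD; first exact: h_le.
  case: i => [|i]; first by rewrite normr0 !mulr_ge0 ?exprn_ge0.
  apply: (@le_trans _ _ (\sum_(a < i.+1) \sum_(b < j.+1)
      2 * M * N * L ^+ r * ((K ^+ a * A ^+ (i - a)) * (K ^+ b * L ^+ (j - b))))).
    apply: le_trans (ler_norm_sum _ _ _) _; apply: ler_sum => a _.
    apply: le_trans (ler_norm_sum _ _ _) _; apply: ler_sum => b _.
    rewrite normrM; apply: le_trans (ler_pM _ _ (k_le _ _) (IH _ _)) _ => //.
    by rewrite exprD le_eqVlt; apply/orP; left; apply/eqP; ring.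
  under eq_bigr => a _ do rewrite -!mulr_sumr.
  under eq_bigr => a _ do rewrite mulrCA.
  rewrite -mulr_suml.
  have SA : \sum_(a < i.+1) K ^+ a * A ^+ (i - a) <= 2 * A ^+ i.
    by apply: geometric_sum_le.
  have SL : \sum_(b < j.+1) K ^+ b * L ^+ (j - b) <= 2 * L ^+ j.
    by apply: geometric_sum_le.
  have P0 : 0 <= 2 * M * N * L ^+ r by rewrite !mulr_ge0 ?exprn_ge0.
  apply: (@le_trans _ _ (2 * A ^+ i * (2 * M * N * L ^+ r * (2 * L ^+ j)))).
    apply: ler_pM => //.
    - by apply: sumr_ge0 => a _; rewrite mulr_ge0 ?exprn_ge0.
    - by rewrite mulr_ge0 //; apply: sumr_ge0 => a _; rewrite mulr_ge0 ?exprn_ge0.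
    - exact: ler_wpM2l.
  have -> : 2 * A ^+ i * (2 * M * N * L ^+ r * (2 * L ^+ j)) =
      M * (A ^+ i * L ^+ j) * (8 * N * L ^+ r) by ring.
  have -> : M * (A ^+ i.+1 * L ^+ j) = M * (A ^+ i * L ^+ j) * A.
    by rewrite exprS; ring.
  by rewrite ler_wpM2l ?mulr_ge0 ?exprn_ge0 // lerDr.
have AL0 : 0 <= A + L by apply: addr_ge0.
exists (2 * M), (A + L); split=> // [|i j]; first by rewrite mulr_ge0.
apply: le_trans (bnd _ _ _) _; rewrite ler_wpM2l ?mulr_ge0 // exprD.
by apply: ler_pM; rewrite ?exprn_ge0 //; apply: lerXn2r;
  rewrite ?nnegrE // ?lerDl ?lerDr.
Qed.

Lemma fixed_point : exists T : germ, T = h + germ_x R * (k * ydrop r T).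
Proof.
exists (mk_germ limit_convergent); apply: cfP => i j.
rewrite germDE cf_xM [LHS]limitE; congr (_ + _).
by case: i => // i; rewrite cf_mulE.
Qed.

End FixedPoint.

(** The inverse is the fixed point for [r = 0] and [h = 1], the sum of the geometric series. *)
Lemma unit_subx k : (1 - germ_x R * k) \is a GRing.unit.
Proof.
have [T TE] := fixed_point 0 k 1.
have dT : ydrop 0 T = T by apply: cfP => i j; rewrite cf_ydrop addn0.
apply/unitrPr; exists T; rewrite mulrBl mul1r {1}TE dT mulrA addrK //.
Qed.

Lemma swap_unit f : (swap f \is a GRing.unit) = (f \is a GRing.unit).
Proof.
have imp g : g \is a GRing.unit -> swap g \is a GRing.unit.
  by case/unitrPr => g' gg'; apply/unitrPr; exists (swap g'); rewrite -swapM gg' swap1.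
by apply/idP/idP => [/imp|/imp//]; rewrite swapK.
Qed.

Lemma unit_suby k : (1 - germ_y R * k) \is a GRing.unit.
Proof.
rewrite -swap_unit swapD swap1 swapN swapM swap_y.
exact: unit_subx.
Qed.

Lemma scale_unit (c : C) f : c != 0 ->
  (c *: f \is a GRing.unit) = (f \is a GRing.unit).
Proof.
move=> c0; have imp (a : C) g : a != 0 -> g \is a GRing.unit -> a *: g \is a GRing.unit.
  move=> a0 /unitrPr[g' gg']; apply/unitrPr; exists (a^-1 *: g').
  rewrite !germ_scaleE mulrACA gg' mulr1 -[_ * _]mulr1 -mulrA -!germ_scaleE.
  by rewrite scalerA mulfV // scale1r.
apply/idP/idP => [|]; last exact: imp.
by move/(imp c^-1); rewrite scalerA mulVf // scale1r; apply; rewrite invr_eq0.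
Qed.

Lemma germ_unitE f : (f \is a GRing.unit) = (cf f 0 0 != 0).
Proof.
apply/idP/idP => [/unitrPr[g fg]|f0].
  have : cf (f * g) 0 0 = 1 by rewrite fg germ1E.
  rewrite cf_mulE !big_ord1; apply: contra_eqN => /eqP ->.
  by rewrite mul0r eq_sym oner_eq0.
(* [v] keeps the constant term and the monomials divisible by y. It is a unit by [unit_suby], and x
   divides [f - v], which leaves a second factor covered by [unit_subx]. *)
pose c := cf f 0 0; pose w := ydrop 1 f; pose v := c *: (1 : germ) + germ_y R * w.
have vu : v \is a GRing.unit.
  rewrite -(@scale_unit c^-1) ?invr_eq0 // scalerDr scalerA mulVf // scale1r.
  have -> : c^-1 *: (germ_y R * w) = - (germ_y R * (- (c^-1 *: w))).
    by rewrite !germ_scaleE; ring.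
  exact: unit_suby.
have -> : f = v * (1 - germ_x R * (- (v^-1 * xdrop 1 (f - v)))).
  rewrite mulrN opprK mulrDr mulr1 mulrCA mulVKr //.
  rewrite -xdrop1_divides; first by rewrite addrC subrK.
  move=> j; rewrite germDE germNE /v germDE germ_scalecE germ1E cf_yM.
  case: j => [|j] /=; first by rewrite mulr1 addr0 subrr.
  by rewrite mulr0 add0r cf_ydrop addn1 subrr.
by rewrite unitrM vu unit_subx.
Qed.

Lemma mult_unit f : f \is a GRing.unit -> mult f = 0%N.
Proof.
rewrite germ_unitE => f0; apply: mult_eq => //; apply: contra f0 => /eqP/polyP/(_ 0%N).
by rewrite coef_hform coef0 /= => /eqP.
Qed.

Lemma mult_gt0_unit f : f != 0 -> (0 < mult f)%N = (f \isn't a GRing.unit).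
Proof. by move=> f0; rewrite germ_unitE negbK mult_gt0. Qed.

Definition yregular r g := (forall j, (j < r)%N -> cf g 0 j = 0) /\ cf g 0 r != 0.

Definition ydegree_lt r f := forall i j, (r <= j)%N -> cf f i j = 0.

(** Writing g = y^r v + x k with [v] a unit, division amounts to solving T = h - x k v^-1
    ([ydrop r T]): the part of [T] of degree less than [r] in y is the remainder, and v^-1 times
    [ydrop r T] is the quotient. *)
Lemma weierstrass_division r g h : yregular r g ->
  exists q s, ydegree_lt r s /\ h = g * q + s.
Proof.
case=> g0 gr; pose v := ydrop r g; pose k := xdrop 1 (ytake r g).
have vu : v \is a GRing.unit by rewrite germ_unitE cf_ydrop.
have gE : g = germ_y R ^+ r * v + germ_x R * k.
  rewrite {1}(ydrop_take r g); congr (_ + _).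
  by apply: xdrop1_divides => j; rewrite cf_ytake; case: ifP => // /g0.
have [T TE] := fixed_point r (- (k * v^-1)) h.
exists (v^-1 * ydrop r T), (ytake r T); split=> [i j rj|].
  by rewrite cf_ytake ltnNge rj.
have {1}-> : h = T + germ_x R * (k * v^-1 * ydrop r T).
  by rewrite {1}TE !mulNr mulrN subrK.
have -> : g * (v^-1 * ydrop r T) =
    germ_y R ^+ r * ydrop r T + germ_x R * (k * v^-1 * ydrop r T).
  by rewrite {1}gE mulrDl -!mulrA mulVKr.
by rewrite {1}(ydrop_take r T) addrAC.
Qed.

(** Lexicographic induction on (i, j): once the earlier coefficients of [q] vanish, the coefficient
    (i, r + j) of [g * q] reduces to that of y^r in [g] times [cf q i j]. *)
Lemma weierstrass_unique r g q : yregular r g -> ydegree_lt r (g * q) -> q = 0.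
Proof.
case=> g0 gr gq; apply: cfP => i; elim/ltn_ind: i => i IHi.
elim/ltn_ind => j IHj; rewrite germ0E.
have := gq i (r + j)%N (leq_addr _ _).
rewrite cf_mulE big_ord_recl [X in _ + X]big1 ?addr0; last first.
  move=> a _; apply: big1 => b _; rewrite IHi ?germ0E ?mulr0 //=.
  by have := ltn_ord a; rewrite /bump /=; lia.
have rj : (r < (r + j).+1)%N by rewrite ltnS leq_addr.
rewrite (bigD1 (Ordinal rj)) //= big1 ?addr0 => [|b]; last first.
  rewrite -val_eqE /= => br; have [/g0->|rb] := ltnP b r; first by rewrite mul0r.
  rewrite subn0 IHj ?germ0E ?mulr0 //; have := ltn_ord b.
  by move: br rb; lia.
by rewrite subn0 addKn => /eqP; rewrite mulf_eq0 (negPf gr) => /eqP.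
Qed.

End Weierstrass.

(** * Blowups and strict transforms *)

Section Blowup.
Variable R : realType.
Local Notation C := (R[i]).
Local Notation germ := (germ R).
Implicit Types (f g h k q : germ) (d : direction R).

Lemma coef_XaddC_exp (c : C) j n :
  (('X + c%:P) ^+ j)`_n = 'C(j, n)%:R * c ^+ (j - n).
Proof.
rewrite addrC exprDn coef_sum.
have E (i : 'I_j.+1) : (c%:P ^+ (j - i) * 'X^i *+ 'C(j, i))`_n =
    if n == i then 'C(j, n)%:R * c ^+ (j - n) else 0.
  rewrite coefMn -polyC_exp coefCM coefXn; case: eqP => [->|_].
    by rewrite mulr1 mulr_natl.
  by rewrite mulr0 mul0rn.
under eq_bigr => i _ do rewrite E.
have [nj|jn] := leqP n j; last first.
  by rewrite bin_small // mul0r big1 // => i _; case: ifP.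
rewrite -ltnS in nj; rewrite (bigD1 (Ordinal nj)) //= eqxx big1 ?addr0 // => i.
by rewrite -val_eqE /= eq_sym => /negPf ->.
Qed.

(** Substituting (x, y) = (u, u (v + c)) turns the homogeneous component of degree [m] into u^m
    times its value at y / x = v + c. *)
Lemma cf_blowup_Some c f m n :
  cf (blowup (Some c) f) m n = (hform m f \Po ('X + c%:P))`_n.
Proof.
rewrite /hform poly_def raddf_sum /= coef_sum; apply: eq_bigr => j _.
by rewrite comp_polyZ comp_Xn_poly coefZ coef_XaddC_exp.
Qed.

Lemma blowup_None f : blowup None f = swap (blowup (Some 0) (swap f)).
Proof.
apply: cfP => m n; rewrite -[RHS]/(cf (blowup (Some 0) (swap f)) n m).
rewrite cf_blowup_Some addr0 comp_polyXr coef_hform /cf /=.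
by case: ifP.
Qed.

Lemma blowupD d : {morph blowup d : f g / f + g}.
Proof.
have S (c : C) : {morph blowup (Some c) : f g / f + g}.
  move=> f g; apply: cfP => m n.
  by rewrite [RHS]germDE !cf_blowup_Some hformD comp_polyD coefD.
by case: d => [c|] f g; rewrite ?blowup_None ?swapD ?S ?swapD.
Qed.

Lemma blowupM d : {morph blowup d : f g / f * g}.
Proof.
have S (c : C) : {morph blowup (Some c) : f g / f * g}.
  move=> f g; apply: cfP => m n.
  rewrite [RHS]cf_mulE cf_blowup_Some hform_mul raddf_sum /= coef_sum.
  apply: eq_bigr => a _; rewrite comp_polyM coefM; apply: eq_bigr => b _.
  by rewrite !cf_blowup_Some.
by case: d => [c|] f g; rewrite ?blowup_None ?swapM ?S ?swapM.
Qed.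

Lemma blowupZ d (a : C) f : blowup d (a *: f) = a *: blowup d f.
Proof.
have S (c : C) (g : germ) : blowup (Some c) (a *: g) = a *: blowup (Some c) g.
  apply: cfP => m n; rewrite [RHS]germ_scalecE !cf_blowup_Some.
  have -> : hform m (a *: g) = a *: hform m g.
    apply/polyP => j; rewrite coefZ !coef_hform germ_scalecE.
    by case: ifP; rewrite ?mulr0.
  by rewrite comp_polyZ coefZ.
by case: d => [c|]; rewrite ?blowup_None ?swapZ ?S ?swapZ.
Qed.

Lemma blowup_inj d : injective (blowup d).
Proof.
have S (c : C) : injective (blowup (Some c)).
  move=> f g fg; apply: hform_inj => m; apply/polyP => n.
  rewrite -[hform m f](comp_polyXaddC_K _ c) -[hform m g](comp_polyXaddC_K _ c).
  congr ((_ \Po _)`_n); apply/polyP => j.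
  by rewrite -!cf_blowup_Some fg.
case: d => [c|] f g; first exact: S.
by rewrite !blowup_None => /swap_inj/S/swap_inj.
Qed.

Lemma blowup0 d : blowup d 0 = 0.
Proof. by apply: (addrI (blowup d 0)); rewrite -blowupD !addr0. Qed.

Lemma blowupN d f : blowup d (- f) = - blowup d f.
Proof. by apply: (addrI (blowup d f)); rewrite -blowupD !subrr blowup0. Qed.

Lemma blowupB d : {morph blowup d : f g / f - g}.
Proof. by move=> f g; rewrite blowupD blowupN. Qed.

Lemma blowup_neq0 d f : f != 0 -> blowup d f != 0.
Proof.
apply: contra => /eqP b0; apply/eqP; apply: (@blowup_inj d).
by rewrite b0 blowup0.
Qed.

Lemma blowup1 d : blowup d 1 = 1.
Proof.
have b1 : blowup d 1 != 0 by apply: blowup_neq0; apply: oner_neq0.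
by apply: (germ_mulfI b1); rewrite -blowupM !mulr1.
Qed.

Lemma blowup_unit d f : f \is a GRing.unit -> blowup d f \is a GRing.unit.
Proof.
by case/unitrPr => g fg; apply/unitrPr; exists (blowup d g); rewrite -blowupM fg blowup1.
Qed.

Lemma exceptional_neq0 d : exceptional d != 0.
Proof.
have x0 : germ_x R != 0.
  apply/eqP => /(congr1 (fun f => cf f 1 0)); rewrite germ0E /cf /= => /eqP.
  by rewrite oner_eq0.
case: d => [c|] //=; apply: contra x0 => /eqP y0.
by rewrite -swap_y y0 swap0.
Qed.

Lemma exceptional_powI d e : injective ( *%R (exceptional d ^+ e)).
Proof.
apply: germ_mulfI; elim: e => [|e IH]; first exact: oner_neq0.
by rewrite exprS germ_mulf_neq0 ?exceptional_neq0.
Qed.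

Lemma strict_step_None f : strict_step None f = swap (strict_step (Some 0) (swap f)).
Proof.
apply: (@exceptional_powI None (mult f)); rewrite -strict_stepP blowup_None.
by rewrite strict_stepP mult_swap swapM swapX swap_x.
Qed.

Lemma cf_strict_step_Some c f i j :
  cf (strict_step (Some c) f) i j = cf (blowup (Some c) f) (i + mult f) j.
Proof. by []. Qed.

(** Hence the strict transform passes through the point of direction [Some c] exactly when [c] is a
    root of the leading form. *)
Lemma strict_step_Some0 c f :
  cf (strict_step (Some c) f) 0 0 = (hform (mult f) f).[c].
Proof.
rewrite cf_strict_step_Some add0n cf_blowup_Some -horner_coef0 horner_comp.
by rewrite !hornerE.
Qed.

Lemma strict_step_None0 f : cf (strict_step None f) 0 0 = (hform (mult f) f)`_(mult f).
Proof.
rewrite strict_step_None [LHS]strict_step_Some0 horner_coef0 mult_swap swap_form.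
by rewrite coef_poly subn0.
Qed.

(** The strict transform restricted to the exceptional curve is a translate of the leading form,
    which is not zero. *)
Lemma exceptional_ndvd_strict d f : f != 0 ->
  ~ germ_dvd (exceptional d) (strict_step d f).
Proof.
have S (c : C) (g : germ) : g != 0 -> ~ germ_dvd (germ_x R) (strict_step (Some c) g).
  move=> g0 [h E]; case/negP: (mult_form_neq0 g0); apply/eqP.
  rewrite -[hform _ _](comp_polyXaddC_K _ c).
  suff -> : hform (mult g) g \Po ('X + c%:P) = 0 by rewrite comp_poly0.
  apply/polyP => n; rewrite -cf_blowup_Some coef0.
  by rewrite -[mult g]add0n -cf_strict_step_Some E mulrC cf_xM.
case: d => [c|] f0 [h E]; first by apply: (@S c f f0); exists h.
apply: (@S 0 (swap f)).
  by apply: contra f0 => /eqP /(congr1 (@swap R)); rewrite swapK swap0 => ->.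
by exists (swap h); rewrite -[strict_step _ _]swapK -strict_step_None E swapM swap_y.
Qed.

(** The power of the exceptional equation in a factorization is determined once the cofactor is not
    divisible by it, so multiplicity and strict transform can be read off. *)
Lemma strict_step_eq d f e g : blowup d f = exceptional d ^+ e * g ->
  ~ germ_dvd (exceptional d) g -> mult f = e /\ strict_step d f = g.
Proof.
move=> fE gE; have [f0|f0] := eqVneq f 0.
  case: gE; exists 0; move: fE; rewrite f0 blowup0 => /esym E0.
  by rewrite mul0r; apply: (@exceptional_powI d e); rewrite E0 mulr0.
have sE := exceptional_ndvd_strict f0 (d := d).
rewrite strict_stepP in fE.
have [me|em|me] := ltngtP (mult f) e.
- case: sE; exists (exceptional d ^+ (e - mult f).-1 * g).
  apply: (@exceptional_powI d (mult f)); rewrite fE mulrAC -exprSr prednK ?subn_gt0 //.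
  by rewrite mulrA -exprD subnKC // ltnW.
- case: gE; exists (exceptional d ^+ (mult f - e).-1 * strict_step d f).
  apply: (@exceptional_powI d e); rewrite -fE mulrAC -exprSr prednK ?subn_gt0 //.
  by rewrite mulrA -exprD subnKC // ltnW.
- by split=> //; apply: (@exceptional_powI d e); rewrite -fE me.
Qed.

Lemma strict_step_neq0 d f : f != 0 -> strict_step d f != 0.
Proof.
by move=> f0; apply: contra (blowup_neq0 d f0) => /eqP s0; rewrite strict_stepP s0 mulr0.
Qed.

Lemma strict_stepM d f g : f != 0 -> g != 0 ->
  strict_step d (f * g) = strict_step d f * strict_step d g.
Proof.
move=> f0 g0; apply: (@exceptional_powI d (mult (f * g))).
by rewrite -strict_stepP blowupM !strict_stepP multM // exprD mulrACA.
Qed.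

Lemma strict_step_unit d f : f \is a GRing.unit -> strict_step d f \is a GRing.unit.
Proof.
by move=> fu; have := blowup_unit d fu; rewrite strict_stepP mult_unit // mul1r.
Qed.

Fact shear_convergent f : convergent (Fps (fun i => Fps (fun j => cf f (i + j)%N j))).
Proof.
have [M [K [M0 K0 fM]]] := cf_bound f.
exists M, ((1 + K) ^+ 2); split=> // [|i j]; first by rewrite exprn_ge0 ?addr_ge0.
rewrite /=; apply: le_trans (fM _ _) _; apply: ler_wpM2l => //; rewrite -exprM.
apply: (@le_trans _ _ ((1 + K) ^+ (i + j + j))).
  by apply: lerXn2r; rewrite ?nnegrE ?addr_ge0 // lerDr.
by apply: ler_weXn2l; [rewrite lerDl | lia].
Qed.

(* Any germ whose x^m-coefficients are polynomials of degree at most m in y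
   comes from below: substitute y / x for y and translate back. *)
Lemma blowup_descent c g : (forall m n, (m < n)%N -> cf g m n = 0) ->
  exists f, blowup (Some c) f = g.
Proof.
move=> g0; pose u : germ := mk_germ (shear_convergent g).
(* [u] is g(x, y / x). Blowing up in direction [- c] and shearing again substitutes y - c x for y in
   [u], which cancels the translation in [blowup (Some c)]. *)
exists (mk_germ (shear_convergent (blowup (Some (- c)) u))).
apply: cfP => m n; rewrite cf_blowup_Some.
set f := mk_germ (shear_convergent (blowup _ _)).
have fE : hform m f = hform m u \Po ('X - c%:P).
  apply/polyP => j; rewrite coef_hform; case: leqP => [jm|mj].
    by rewrite -[LHS]/(cf (blowup (Some (- c)) u) (m - j + j) j) subnK // cf_blowup_Some polyCN.
  rewrite nth_default // size_comp_poly2 ?size_XsubC //.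
  by apply: leq_trans mj; apply: size_poly.
have -> : hform m f \Po ('X + c%:P) = hform m u.
  by rewrite fE; have := comp_polyXaddC_K (hform m u) (- c); rewrite polyCN opprK.
rewrite coef_hform; case: leqP => [nm|mn]; last by rewrite g0.
by rewrite -[LHS]/(cf g (m - n + n) n) subnK.
Qed.

End Blowup.

(** * Contraction of curves *)

Section Contraction.
Variable R : realType.
Local Notation C := (R[i]).
Local Notation germ := (germ R).
Implicit Types (f g h k q : germ) (d : direction R).

Definition ideal2 f g h := exists u v, h = u * f + v * g.

Lemma subspace_ideal2 f g : subspace (ideal2 f g).
Proof.
split=> [|a _ _ [u1 [v1 ->]] [u2 [v2 ->]]]; first by exists 0, 0; rewrite !mul0r addr0.
exists (a *: u1 + u2), (a *: v1 + v2); rewrite !germ_scaleE; ring.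
Qed.

Definition all_germs (h : germ) := True.

Lemma subspace_all : subspace all_germs. Proof. by []. Qed.

Lemma germ_dvdM f g h : germ_dvd f g -> germ_dvd f (h * g).
Proof. by case=> k ->; exists (h * k); rewrite mulrA. Qed.

Lemma germ_dvdD f g h : germ_dvd f g -> germ_dvd f h -> germ_dvd f (g + h).
Proof. by move=> [k ->] [l ->]; exists (k + l); rewrite mulrDl. Qed.

Lemma germ_dvdB f g h : germ_dvd f g -> germ_dvd f h -> germ_dvd f (g - h).
Proof. by move=> [k ->] [l ->]; exists (k - l); rewrite mulrBl. Qed.

Lemma germ_dvd_trans f g h : germ_dvd f g -> germ_dvd g h -> germ_dvd f h.
Proof. by move=> [k ->] [l ->]; exists (l * k); rewrite mulrA. Qed.

Lemma ydegree_lt_blowup r c f : ydegree_lt r f -> ydegree_lt r (blowup (Some c) f).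
Proof.
move=> fr m n rn; rewrite cf_blowup_Some nth_default // size_comp_poly2 ?size_XaddC //.
apply: leq_trans rn; apply/leq_sizeP => j rj; rewrite coef_hform.
by case: ifP => // _; apply: fr.
Qed.

Lemma blowup_descent_pow c r f : ydegree_lt r.+1 f ->
  exists h, blowup (Some c) h = germ_x R ^+ r * f.
Proof.
move=> fr; apply: blowup_descent => m n mn; rewrite xnE; case: leqP => // rm.
by apply: fr; lia.
Qed.

Lemma yregular_exists g : ~ germ_dvd (germ_x R) g -> exists r, yregular r g.
Proof.
move=> gx; have [j gj] : exists j, cf g 0 j != 0.
  apply: contrapT => nj; apply: gx; exists (xdrop 1 g); rewrite mulrC.
  apply: xdrop1_divides => j; apply/eqP/negPn/negP => gj.
  by apply: nj; exists j.
have [r gr rmin] := @ex_minnP (fun j => cf g 0 j != 0) (ex_intro _ j gj).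
exists r; split=> // l lr; apply/eqP/negPn/negP => /rmin.
by rewrite leqNgt lr.
Qed.

Lemma cf_mul0 f g j :
  cf (f * g) 0 j = \sum_(b < j.+1) cf f 0 b * cf g 0 (j - b)%N.
Proof. by rewrite cf_mulE big_ord1. Qed.

Lemma yregular_mul_lt r g h j : yregular r g -> (j < r)%N -> cf (g * h) 0 j = 0.
Proof.
case=> g0 _ jr; rewrite cf_mul0 big1 // => b _; rewrite g0 ?mul0r //.
by have := ltn_ord b; lia.
Qed.

Lemma yregular_mul_eq r g h : yregular r g -> cf (g * h) 0 r = cf g 0 r * cf h 0 0.
Proof.
case=> g0 _; rewrite cf_mul0 (bigD1 ord_max) //= subnn big1 ?addr0 // => b.
rewrite -val_eqE /= => br; rewrite g0 ?mul0r //.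
by have := ltn_ord b; lia.
Qed.

(** Dividing y^r by [g] gives y^r - s = g q; comparing the coefficients of y^r on x = 0 shows that
    [q] is a unit. *)
Lemma weierstrass_preparation r g : yregular r g -> exists w,
  [/\ germ_assoc g w, ydegree_lt r.+1 w & forall j, cf w 0 j = (j == r)%:R].
Proof.
move=> gr; have [q [s [sr E]]] := weierstrass_division (germ_y R ^+ r) gr.
have yE i j : cf (germ_y R ^+ r) i j = ((i == 0%N) && (j == r))%:R.
  rewrite -[germ_y R ^+ r]mulr1 ynE germ1E; case: leqP => [rj|jr].
    by rewrite subn_eq0 [j == r]eqn_leq rj andbT.
  by rewrite (ltn_eqF jr) andbF.
have wE : germ_y R ^+ r - s = g * q by rewrite E addrK.
have q0 : cf g 0 r * cf q 0 0 = 1.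
  rewrite -yregular_mul_eq // -wE germDE germNE yE !eqxx sr ?leqnn //.
  by rewrite oppr0 addr0.
exists (g * q); split.
- exists q; last exact: mulrC.
  rewrite germ_unitE; apply: contra_eq_neq q0 => ->.
  by rewrite mulr0 eq_sym oner_neq0.
- move=> i j rj; rewrite -wE germDE germNE yE sr ?(ltnW rj) //.
  by rewrite (gtn_eqF rj) andbF oppr0 addr0.
- move=> j; have [jr|rj|->] := ltngtP j r.
  + exact: yregular_mul_lt gr jr.
  + by rewrite -wE germDE germNE yE sr ?(ltnW rj) // (gtn_eqF rj) oppr0 addr0.
  + by rewrite yregular_mul_eq.
Qed.

(** On x = 0 the germ [g] becomes y^r times a unit, so the powers of y below [r] form a basis. *)
Lemma codim_ideal2_x r g : yregular r g -> codim all_germs (ideal2 g (germ_x R)) r.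
Proof.
move=> gr; exists (fun j => germ_y R ^+ j).
have sE (c : 'I_r -> C) i j :
    cf (\sum_l c l *: germ_y R ^+ l) i j =
    if i == 0%N then if insub j is Some l then c l else 0 else 0.
  rewrite germ_sumE; have yE (l : 'I_r) : cf (c l *: germ_y R ^+ l) i j =
      if (i == 0%N) && (j == l :> nat) then c l else 0.
    rewrite germ_scalecE -[germ_y R ^+ l]mulr1 ynE germ1E.
    case: leqP => [lj|jl]; last by rewrite (ltn_eqF jl) andbF mulr0.
    rewrite subn_eq0 [j == l :> nat]eqn_leq lj andbT.
    by case: (_ && _); rewrite ?mulr1 ?mulr0.
  under eq_bigr => l _ do rewrite yE.
  case: eqP => _ /=; last by rewrite big1.
  case: insubP => [l _ lj|]; last first.
    move=> jr; rewrite big1 // => l _; case: eqP => // jl.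
    by rewrite jl ltn_ord in jr.
  rewrite (bigD1 l) //= lj eqxx big1 ?addr0 // => l'.
  by rewrite -val_eqE /= lj eq_sym => /negPf ->.
split=> // [c [u [v E]] j|h _].
- have := sE c 0%N j; rewrite E eqxx valK => <-.
  rewrite germDE mulrC (yregular_mul_lt _ gr) // mulrC cf_xM add0r.
  by [].
- have [q [s [sr ->]]] := weierstrass_division h gr.
  exists (fun l : 'I_r => cf s 0 l), q.
  exists (xdrop 1 (s - \sum_(l < r) cf s 0 l *: germ_y R ^+ l)).
  rewrite [g * q]mulrC -addrA [X in _ = _ + X]mulrC -xdrop1_divides // => j.
  rewrite germDE germNE sE eqxx; case: insubP => [l _ ->|]; first by rewrite subrr.
  by rewrite -leqNgt subr0 => /sr.
Qed.

(** The Weierstrass polynomial [w] of [g] has degree [r] in y, so x^r w comes from a germ [f] below,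
    of multiplicity [r]. As [f] is also regular of order [r] in y, divisions by [f] and by [w] can
    be compared. *)
Lemma contraction_Some c g : ~ germ_dvd (germ_x R) g -> exists f,
  [/\ germ_assoc g (strict_step (Some c) f),
      codim all_germs (ideal2 g (germ_x R)) (mult f),
      forall h, germ_dvd g (blowup (Some c) h) -> germ_dvd f h,
      forall k, exists h, germ_dvd g (blowup (Some c) h - germ_x R ^+ mult f * k) &
      hform (mult f) f = ('X - c%:P) ^+ mult f].
Proof.
move=> gx; have [r gr] := yregular_exists gx.
have [w [gw wr w0]] := weierstrass_preparation gr.
have [f fE] := blowup_descent_pow c wr.
have wx : ~ germ_dvd (germ_x R) w.
  move=> [v wE]; have := w0 r; rewrite wE mulrC cf_xM eqxx => /eqP.
  by rewrite eq_sym oner_eq0.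
have [mf sf] := strict_step_eq (d := Some c) fE wx.
have wreg : yregular r w.
  split=> [j jr|]; first by rewrite w0 (ltn_eqF jr).
  by rewrite w0 eqxx oner_neq0.
have ff : hform r f = ('X - c%:P) ^+ r.
  rewrite -[LHS](comp_polyXaddC_K _ c).
  have -> : hform r f \Po ('X + c%:P) = 'X^r.
    apply/polyP => n; rewrite -cf_blowup_Some fE xnE leqnn subnn w0 coefXn //.
  by rewrite comp_Xn_poly.
have freg : yregular r f.
  have fj j : cf f 0 j = (hform j f)`_j by rewrite coef_hform leqnn subnn.
  split=> [j jr|]; first by rewrite fj mult_form_lt ?coef0 ?mf.
  rewrite fj ff; have := monicP (monic_exp r (monicXsubC c)).
  by rewrite lead_coefE size_exp_XsubC /= => ->; rewrite oner_neq0.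
have [u uu wE] := gw.
have dvd_w h : germ_dvd g h -> germ_dvd w h.
  by move=> [v ->]; exists (v * u^-1); rewrite wE -mulrA mulKr.
have gdw : germ_dvd g w by exists u.
exists f; split; rewrite ?mf ?sf //.
- exact: codim_ideal2_x.
(* The remainder [s] of [h] by [f] pulls back to a germ of degree less than [r] in y that [w]
   divides, so it vanishes by uniqueness. *)
- move=> h /dvd_w wh; have [k [s [sr hE]]] := weierstrass_division h freg.
  exists k; rewrite hE mulrC; suff -> : s = 0 by rewrite addr0.
  apply: (@blowup_inj _ (Some c)); rewrite blowup0.
  have [t tE] : germ_dvd w (blowup (Some c) s).
    have -> : blowup (Some c) s = blowup (Some c) h - blowup (Some c) f * blowup (Some c) k.
      by rewrite hE blowupD blowupM addrAC subrr add0r.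
    apply: germ_dvdB => //; exists (germ_x R ^+ r * blowup (Some c) k).
    by rewrite fE mulrAC.
  rewrite tE mulrC (@weierstrass_unique _ r w t) ?mulr0 //.
  by rewrite mulrC -tE; apply: ydegree_lt_blowup.
(* Modulo [w], the germ [k] may be replaced by its remainder, whose product with x^r comes from
   below. *)
- move=> k; have [q [s [sr kE]]] := weierstrass_division k wreg.
  have [h hE] : exists h, blowup (Some c) h = germ_x R ^+ r * s.
    by apply: blowup_descent_pow => i j /ltnW; apply: sr.
  exists h; apply: germ_dvd_trans gdw _; exists (- (germ_x R ^+ r * q)).
  by rewrite hE kE; ring.
Qed.

(* Contracting a curve at a point of the exceptional curve replaces unique
   factorization: it shows that irreducible germs have a single tangent
   direction and irreducible strict transforms. *)
Lemma contraction d g : ~ germ_dvd (exceptional d) g -> exists f,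
  [/\ germ_assoc g (strict_step d f),
      codim all_germs (ideal2 g (exceptional d)) (mult f),
      forall h, germ_dvd g (blowup d h) -> germ_dvd f h,
      forall k, exists h, germ_dvd g (blowup d h - exceptional d ^+ mult f * k) &
      forall d', d' <> d -> strict_step d' f \is a GRing.unit].
Proof.
case: d => [c|] gE.
  have [f [sf cf_ kf df ff]] := contraction_Some c gE; exists f; split=> // d' d'c.
  rewrite germ_unitE; case: d' d'c => [c'|] d'c.
    rewrite strict_step_Some0 ff horner_exp !hornerE expf_neq0 // subr_eq0.
    by apply: contra_notN d'c => /eqP ->.
  rewrite strict_step_None0 ff.
  have := monicP (monic_exp (mult f) (monicXsubC c)).
  by rewrite lead_coefE size_exp_XsubC /= => ->; rewrite oner_neq0.
have swap_dvd a b : germ_dvd (swap a) (swap b) <-> germ_dvd a b.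
  split=> [[k E]|[k ->]]; last by exists (swap k); rewrite swapM.
  by exists (swap k); rewrite -[b]swapK E swapM swapK.
have gx : ~ germ_dvd (germ_x R) (swap g) by rewrite -swap_y swap_dvd.
have [f [[u uu sf] cf_ kf df ff]] := contraction_Some 0 gx.
exists (swap f); rewrite strict_step_None swapK mult_swap; split.
- exists (swap u); first by rewrite swap_unit.
  by rewrite sf swapM swapK.
- apply: (codim_image (phi := @swap R)) cf_ => //.
  + by move=> a v w; rewrite swapD swapZ.
  + exact: subspace_ideal2.
  + move=> h _; split=> [[u' [v E]]|[u' [v ->]]]; exists (swap u'), (swap v).
      by rewrite -[h]swapK E swapD !swapM swap_y.
    by rewrite swapD !swapM swapK swap_x.
  + move=> h _; exists (swap h) => //; rewrite swapK subrr.
    by case: (subspace_ideal2 g (germ_y R)).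
- move=> h; rewrite blowup_None -[X in germ_dvd X _]swapK => /swap_dvd /kf /swap_dvd.
  by rewrite swapK.
- move=> k; have [h hE] := df (swap k); exists (swap h).
  rewrite blowup_None swapK -[g]swapK -[k]swapK -[exceptional None]swap_x -swapX.
  by rewrite -swapM -swapN -swapD; apply/swap_dvd.
- case=> [c' _|//]; rewrite germ_unitE strict_step_Some0 mult_swap.
  (* The leading form of [f] is a power of y; after the exchange it is a power of x, the constant 1
     as a polynomial in y / x, without roots. *)
  have -> : hform (mult f) (swap f) = 1.
    apply/polyP => j; rewrite swap_form coef_poly ff subr0 coefXn coef1 ltnS.
    case: leqP => jf; last by rewrite gtn_eqF //; lia.
    by congr ((nat_of_bool _)%:R); lia.
  by rewrite hornerE oner_neq0.
Qed.

End Contraction.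

(** * Noether's formula *)

Section Noether.
Variable R : realType.
Local Notation C := (R[i]).
Local Notation germ := (germ R).
Implicit Types (f g h k q : germ) (d : direction R) (P Q : ipoint R).

Definition smooth f := cf f 0 0 = 0 /\ (cf f 1 0 != 0) || (cf f 0 1 != 0).

Lemma smooth_swap f : smooth f -> smooth (swap f).
Proof. by case=> f0 f1; split=> //; rewrite orbC. Qed.

Lemma smooth_neq0 f : smooth f -> f != 0.
Proof. by case=> _; apply: contraTneq => ->; rewrite !germ0E !eqxx. Qed.

Lemma smooth_nonunit f : smooth f -> f \isn't a GRing.unit.
Proof. by case=> f0 _; rewrite germ_unitE f0 eqxx. Qed.

Lemma smooth_mult f : smooth f -> mult f = 1%N.
Proof.
case=> f0 f1; apply: mult_eq => [[|//] _|].
  by apply/polyP => j; rewrite coef_hform coef0; case: j => [|j] //=; rewrite f0.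
apply: contraTneq f1 => /polyP E.
have := E 0%N; have := E 1%N; rewrite !coef_hform !coef0 /= subn0 subnn => -> ->.
by rewrite !eqxx.
Qed.

Lemma smooth_exceptional d : smooth (exceptional d).
Proof.
by case: d => [c|]; split; rewrite /cf /= ?eqxx //= oner_eq0 ?orbT.
Qed.

(** Modulo a germ regular of order 1 in y, each germ is congruent to a unique germ in x alone, and
    such germs are closed under products in a domain. The other case follows by exchanging
    coordinates. *)
Lemma smooth_prime f g h : smooth f -> germ_dvd f (g * h) ->
  germ_dvd f g \/ germ_dvd f h.
Proof.
have S (a b c : germ) : yregular 1 a -> germ_dvd a (b * c) ->
    germ_dvd a b \/ germ_dvd a c.
  move=> ar; have [q [s [sr ->]]] := weierstrass_division b ar.
  have [q' [s' [sr' ->]]] := weierstrass_division c ar => -[k E].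
  have ss : ydegree_lt 1 (s * s').
    move=> i j j0; rewrite cf_mulE big1 // => l _; rewrite big1 // => m _.
    have [m0|m1] := posnP m; last by rewrite sr ?mul0r.
    by rewrite m0 subn0 sr' ?mulr0.
  have E' : s * s' = a * (k - q * (a * q' + s') - s * q').
    have -> : a * (k - q * (a * q' + s') - s * q') =
        k * a - a * q * (a * q' + s') - a * q' * s by ring.
    by rewrite -E; ring.
  have ss0 : s * s' = 0.
    rewrite E' in ss *; by rewrite (weierstrass_unique ar ss) mulr0.
  have [->|s0] := eqVneq s 0; first by left; exists q; rewrite addr0 mulrC.
  have [->|s'0] := eqVneq s' 0; first by right; exists q'; rewrite addr0 mulrC.
  by case/eqP: (germ_mulf_neq0 s0 s'0).
case=> f0 /orP[f1|f1] fgh; last first.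
  by apply: S => //; split=> // -[|//] _.
have [||[k E]|[k E]] := S (swap f) (swap g) (swap h).
- by split=> // -[|//] _.
- by case: fgh => k E; exists (swap k); rewrite -!swapM E.
- by left; exists (swap k); rewrite -[g]swapK E swapM swapK.
- by right; exists (swap k); rewrite -[h]swapK E swapM swapK.
Qed.

(** The first clause says that [g] is not a zero divisor modulo [f]; it makes [n] additive under
    products of the second germ. *)
Definition isect f g n :=
  (forall h, germ_dvd f (g * h) -> germ_dvd f h) /\
  codim (@all_germs R) (ideal2 f g) n.

Lemma isect_unit f g : g \is a GRing.unit -> isect f g 0.
Proof.
move=> gu; split=> [h [k E]|].
  by exists (g^-1 * k); rewrite -mulrA -E mulKr.
exists (fun=> 0); split=> [[]|c _ []|h _] //; exists (fun=> 0).
by exists 0, (h * g^-1); rewrite big_ord0 subr0 mul0r add0r divrK.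
Qed.

(** Multiplication by [a] identifies O/(f, b) with (f, a)/(f, ab). *)
Lemma isect_mul f a b m n : isect f a m -> isect f b n -> isect f (a * b) (m + n).
Proof.
move=> [fa ca] [fb cb]; split=> [h|]; first by rewrite -mulrA => /fa/fb.
apply: (codim_add (@subspace_all R) (subspace_ideal2 f a) (subspace_ideal2 f (a * b))) ca _.
- by move=> _ [u [v ->]]; exists u, (v * b); rewrite -mulrA [b * a]mulrC.
- by [].
apply: (codim_image (phi := *%R a)) cb.
- by move=> c u v; rewrite mulrDr !germ_scaleE mulrCA.
- exact: subspace_all.
- exact: subspace_ideal2.
- by move=> h _; exists 0, h; rewrite mul0r add0r mulrC.
- move=> h _; split=> [[u [v E]]|[u [v ->]]]; last first.
    by exists (a * u), v; rewrite mulrDr; congr (_ + _); ring.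
  have [w hE] : germ_dvd f (h - v * b).
    by apply: fa; exists u; rewrite mulrBr E; ring.
  by exists w, v; rewrite -hE subrK.
- by move=> _ [u [v ->]]; exists v => //; exists u, 0; ring.
Qed.

Lemma isect_pow f a m e : isect f a m -> isect f (a ^+ e) (e * m).
Proof.
move=> fa; elim: e => [|e IH]; first by apply: isect_unit; apply: unitr1.
by rewrite exprS mulSn; apply: isect_mul.
Qed.

Lemma strict_step_0 d : strict_step d 0 = 0.
Proof.
have := strict_stepP d (0 : germ); rewrite blowup0 => E.
by apply: (@exceptional_powI _ d (mult (0 : germ))); rewrite -E mulr0.
Qed.

Lemma assoc_unit f g : germ_assoc f g -> (g \is a GRing.unit) = (f \is a GRing.unit).
Proof. by case=> u uu ->; rewrite unitrM uu. Qed.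

(** Multiplicity 0 would put 1 in the ideal of [g] and the exceptional equation, which both vanish
    at the origin. *)
Lemma contraction_nonunit d f g : germ_assoc g (strict_step d f) ->
  ~ germ_dvd (exceptional d) g -> g \isn't a GRing.unit ->
  codim (@all_germs R) (ideal2 g (exceptional d)) (mult f) ->
  f != 0 /\ f \isn't a GRing.unit.
Proof.
move=> gf gE gu cg; have f0 : f != 0.
  apply/eqP => f0; move: gf; rewrite f0 strict_step_0 => -[u uu /eqP].
  apply/negP; rewrite eq_sym; apply: germ_mulf_neq0.
    by apply: contraTneq uu => ->; rewrite unitr0.
  by apply/eqP => g0; apply: gE; exists 0; rewrite mul0r.
split=> //; rewrite -mult_gt0_unit // lt0n; apply/eqP => m0; move: cg; rewrite m0.
case=> e [_ _ /(_ 1 I)[c [u [v]]]]; rewrite big_ord0 subr0.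
move=> /(congr1 (fun t => cf t 0 0)); rewrite germ1E germDE !cf_mulE !big_ord1.
have [-> _] := smooth_exceptional d.
move: gu; rewrite germ_unitE negbK => /eqP ->; rewrite !mulr0 addr0 => /eqP.
by rewrite oner_eq0.
Qed.

Lemma irreducible_neq0 f : germ_irreducible f -> f != 0.
Proof.
case=> fu firr; apply/eqP => f0; have := firr 0 0; rewrite f0 mul0r unitr0.
by case.
Qed.

Lemma assoc_strict_step d f g : f != 0 -> germ_assoc f g ->
  germ_assoc (strict_step d f) (strict_step d g).
Proof.
move=> f0 [u uu ->]; exists (strict_step d u); first exact: strict_step_unit.
rewrite strict_stepM //; by apply: contraTneq uu => ->; rewrite unitr0.
Qed.

Lemma assoc_mult f g : f != 0 -> germ_assoc f g -> mult g = mult f.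
Proof.
move=> f0 [u uu ->]; rewrite multM ?(mult_unit uu) //.
by apply: contraTneq uu => ->; rewrite unitr0.
Qed.

Lemma dvd_strict_blowup d f : germ_dvd (strict_step d f) (blowup d f).
Proof. by exists (exceptional d ^+ mult f); rewrite -strict_stepP. Qed.

Lemma irreducible_dvd_assoc f g : germ_irreducible f -> germ_dvd g f ->
  g \isn't a GRing.unit -> germ_assoc g f.
Proof.
move=> [_ firr] [k fE] gu; case: (firr k g fE) => [ku|]; first by exists k.
by rewrite (negPf gu).
Qed.

Lemma assoc_dvd f g : germ_assoc f g -> germ_dvd f g.
Proof. by case=> u _ ->; exists u. Qed.

Lemma assoc_sym f g : germ_assoc f g -> germ_assoc g f.
Proof. by case=> u uu ->; exists u^-1; rewrite ?unitrV // mulKr. Qed.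

Lemma assoc_trans f g h : germ_assoc f g -> germ_assoc g h -> germ_assoc f h.
Proof.
by move=> [u uu ->] [v vu ->]; exists (v * u); rewrite ?unitrM ?uu ?vu // mulrA.
Qed.

(** The contraction of the strict transform divides [f], hence is associate to it, and the
    properties of contractions pass to [f]. *)
Lemma irreducible_strict d f : germ_irreducible f ->
  strict_step d f \isn't a GRing.unit ->
  [/\ codim (@all_germs R) (ideal2 (strict_step d f) (exceptional d)) (mult f),
      forall h, germ_dvd (strict_step d f) (blowup d h) -> germ_dvd f h,
      forall k, exists h, germ_dvd (strict_step d f)
        (blowup d h - exceptional d ^+ mult f * k),
      forall d', d' <> d -> strict_step d' f \is a GRing.unit &
      germ_irreducible (strict_step d f)].
Proof.
move=> firr su; have f0 := irreducible_neq0 firr.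
have sE := exceptional_ndvd_strict f0 (d := d).
have [f1 [gf1 cf1 kf1 df1 uf1]] := contraction sE.
have [f10 f1u] := contraction_nonunit gf1 sE su cf1.
have ff1 : germ_assoc f1 f.
  by apply: irreducible_dvd_assoc => //; apply/kf1/dvd_strict_blowup.
have mf := assoc_mult f10 ff1.
split; rewrite ?mf //.
- by move=> h /kf1; apply: germ_dvd_trans; apply/assoc_dvd/assoc_sym.
- move=> d' /uf1 d'u; by rewrite (assoc_unit (assoc_strict_step d' f10 ff1)).
(* A nonunit factor [a] of the strict transform also contracts to an associate of [f], so [a] is
   associate to the whole strict transform. *)
- split=> // a b E; case: (boolP (a \is a GRing.unit)) => [|au]; [by left|right].
  have aE : ~ germ_dvd (exceptional d) a.
    by move=> aE; apply: sE; rewrite E mulrC; apply: germ_dvdM.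
  have [f2 [gf2 cf2 kf2 _ _]] := contraction aE.
  have [f20 f2u] := contraction_nonunit gf2 aE au cf2.
  have ff2 : germ_assoc f2 f.
    apply: irreducible_dvd_assoc => //; apply: kf2.
    by apply: germ_dvd_trans (dvd_strict_blowup d f); exists b; rewrite E mulrC.
  have [u uu] := assoc_trans gf2 (assoc_strict_step d f20 ff2).
  rewrite E => abE.
  have a0 : a != 0 by apply/eqP => a0; apply: aE; exists 0; rewrite mul0r.
  by rewrite (_ : b = u) //; apply: (germ_mulfI a0); rewrite abE mulrC.
Qed.

(** Either the leading form lacks the term y^m, and x = 0 is tangent, or it has positive degree and
    a root, C being algebraically closed. *)
Lemma direction_exists f : f != 0 -> f \isn't a GRing.unit ->
  exists d, strict_step d f \isn't a GRing.unit.
Proof.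
move=> f0; rewrite -mult_gt0_unit // => m0.
have [pm|pm] := eqVneq (hform (mult f) f)`_(mult f) 0.
  by exists None; rewrite germ_unitE strict_step_None0 pm eqxx.
have /closed_rootP[c /eqP rc] : size (hform (mult f) f) != 1%N.
  apply: contra pm => /eqP sz; apply/eqP/nth_default.
  by rewrite sz.
by exists (Some c); rewrite germ_unitE strict_step_Some0 rc eqxx.
Qed.

Lemma isect_exceptional d f : f != 0 ->
  codim (@all_germs R) (ideal2 (strict_step d f) (exceptional d)) (mult f) ->
  isect (strict_step d f) (exceptional d) (mult f).
Proof.
move=> f0 cf_; split=> // h [k E].
have [] // : germ_dvd (exceptional d) k \/ germ_dvd (exceptional d) (strict_step d f).
- apply: smooth_prime; first exact: smooth_exceptional.
  by rewrite -E; exists h; rewrite mulrC.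
- move=> [k' kE]; exists k'; apply: (germ_mulfI (exceptional_neq0 d)).
  by rewrite E kE; ring.
- by move/(exceptional_ndvd_strict f0).
Qed.

(* With pi the blowup, B = pi(O) + (f') has finite codimension in O', hence
   so has G B + (f') in G O' + (f'), and these codimensions are equal. *)
Lemma noether_step d f g n : germ_irreducible f ->
  strict_step d f \isn't a GRing.unit -> 
  isect (strict_step d f) (strict_step d g) n ->
  isect f g (mult f * mult g + n).
Proof.
move=> firr su; have [cE kf df _ _] := irreducible_strict firr su.
have f0 := irreducible_neq0 firr; set f' := strict_step d f in su cE kf df *.
have iE : isect f' (exceptional d) (mult f) by apply: isect_exceptional.
move=> ig; have iG : isect f' (blowup d g) (mult f * mult g + n).
  by rewrite strict_stepP mulnC; apply: isect_mul ig; apply: isect_pow.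
have [nG cG] := iG; set N := (_ + n)%N in iG cG *.
have f'f : germ_dvd f' (blowup d f) by apply: dvd_strict_blowup.
split=> [h fgh|].
  apply/kf/nG; rewrite -blowupM; case: fgh => k ->.
  by rewrite blowupM; apply: germ_dvdM.
(* [D] is the image of [B] under multiplication by the total transform G = [blowup d g], modulo
   [f']. *)
pose B h := exists k, germ_dvd f' (h - blowup d k).
pose D h := exists k, germ_dvd f' (h - blowup d g * blowup d k).
have f'0 : germ_dvd f' 0 by exists 0; rewrite mul0r.
have f'Z a h : germ_dvd f' h -> germ_dvd f' (a *: h).
  by move=> f'h; rewrite germ_scaleE; apply: germ_dvdM.
have sB : subspace B.
  split=> [|a u v [k ku] [l lv]]; first by exists 0; rewrite blowup0 subrr.
  exists (a *: k + l); rewrite blowupD blowupZ opprD addrACA -scalerBr.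
  by apply: germ_dvdD => //; apply: f'Z.
have sD : subspace D.
  split=> [|a u v [k ku] [l lv]]; first by exists 0; rewrite blowup0 mulr0 subrr.
  exists (a *: k + l); rewrite blowupD blowupZ mulrDr opprD addrACA.
  apply: germ_dvdD => //; rewrite !germ_scaleE mulrCA -mulrBr.
  exact: germ_dvdM.
(* [df] shows that [B] contains the ideal of [f'] and the power [mult f] of the exceptional
   equation, of finite codimension. *)
have [delta cB] : exists delta, codim (@all_germs R) B delta.
  have [_ cEm] := isect_pow (mult f) iE.
  apply: codim_bigger cEm => //; first exact: subspace_ideal2.
  move=> _ [u [v ->]]; have [k kE] := df v; exists k.
  have -> : u * f' + v * exceptional d ^+ mult f - blowup d k =
     u * f' - (blowup d k - exceptional d ^+ mult f * v).
    by rewrite opprB addrA [v * _]mulrC.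
  by apply: germ_dvdB => //; exists u.
have cD : codim (ideal2 f' (blowup d g)) D delta.
  apply: (codim_image (phi := *%R (blowup d g))) cB => //.
  - by move=> c u v; rewrite mulrDr !germ_scaleE mulrCA.
  - by move=> h _; exists 0, h; rewrite mul0r add0r mulrC.
  - move=> h _; split=> -[k hk]; exists k; first by apply: nG; rewrite mulrBr.
    by rewrite -mulrBr; apply: germ_dvdM.
  - move=> _ [u [v ->]]; exists v => //; exists 0; rewrite blowup0 mulr0 subr0.
    by exists u; ring.
have DB h : D h -> B h by move=> [k hk]; exists (g * k); rewrite blowupM.
(* Both chains from O' to [D], through (f', G) and through [B], start or end with a step of
   codimension [delta]; cancelling it leaves [N] for [D] in [B]. *)
have cDall : codim (@all_germs R) D (delta + N).
  rewrite addnC; apply: (codim_add _ _ sD _ _ cG cD) => //.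
    exact: subspace_ideal2.
  move=> h [k [u E]]; exists u, (blowup d k).
  by rewrite -E [blowup d k * _]mulrC subrK.
have cBD : codim B D N by apply: (codim_sub _ sB sD DB _ cB cDall).
(* The pullback induces an isomorphism of O/(f, g) onto [B] modulo [D]; injectivity is [kf]. *)
apply: (codim_preimage (phi := blowup d)) cBD => //.
- by move=> a u v; rewrite blowupD blowupZ.
- by move=> h _; exists h; rewrite subrr.
- move=> h _; split=> [[k]|[u [v ->]]].
    rewrite -blowupM -blowupB => /kf [u E]; exists u, k.
    by rewrite -E [k * g]mulrC subrK.
  exists v; rewrite blowupD !blowupM [blowup d v * _]mulrC addrK.
  exact: germ_dvdM.
- by move=> h [k hk]; exists k => //; exists 0; rewrite blowup0 mulr0 subr0.
Qed.

Lemma strict_unit P f : f \is a GRing.unit -> strict [::] P f \is a GRing.unit.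
Proof.
rewrite /strict /= drop0; elim: P f => [//|d P IH] f fu /=.
by apply: IH; apply: strict_step_unit.
Qed.

Lemma multiplicity_unit P f : f \is a GRing.unit -> multiplicity P f = 0%N.
Proof. by move=> fu; apply/mult_unit/strict_unit. Qed.

Lemma multiplicity_cons d P f : multiplicity (d :: P) f = multiplicity P (strict_step d f).
Proof. by rewrite /multiplicity /strict /= drop0. Qed.

(** [N] exceeds the length of every common point and drops by one at each blowup. [S] may contain
    further points, whose terms are zero. *)
Lemma noether_sum N (S : seq (ipoint R)) f g : germ_irreducible f -> g != 0 ->
  uniq S ->
  (forall Q, (0 < multiplicity Q f)%N -> (0 < multiplicity Q g)%N ->
    Q \in S /\ (size Q < N)%N) ->
  isect f g (\sum_(Q <- S) multiplicity Q f * multiplicity Q g)%N.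
Proof.
elim: N S f g => [|N IH] S f g firr g0 uS HS;
  have f0 := irreducible_neq0 firr; have [fu _] := firr;
  (have [gu|gu] := boolP (g \is a GRing.unit);
    first by rewrite big1 => [|Q _]; rewrite ?(multiplicity_unit _ gu) ?muln0 //;
      apply: isect_unit).
  by have [||//] := HS [::]; rewrite /multiplicity /strict /= mult_gt0_unit.
have [OS _] : [::] \in S /\ (0 < N.+1)%N.
  by apply: (HS [::]); rewrite /multiplicity /strict /= mult_gt0_unit.
have [d su] := direction_exists f0 fu.
have [_ _ _ oth irr'] := irreducible_strict firr su.
pose S' := [seq behead Q | Q <- S & ohead Q == Some d].
have {IH}isec : isect (strict_step d f) (strict_step d g)
    (\sum_(Q <- S') multiplicity Q (strict_step d f) * multiplicity Q (strict_step d g))%N.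
  apply: IH => //; first exact: strict_step_neq0.
    rewrite map_inj_in_uniq ?filter_uniq // => P Q.
    rewrite !mem_filter => /andP[/eqP + _] /andP[/eqP + _].
    by case: P Q => [|a P] [|b Q] //= [->] [->] ->.
  move=> Q Qf Qg; have [] := HS (d :: Q); rewrite ?multiplicity_cons // => QS sQ.
  by split=> //; apply/mapP; exists (d :: Q); rewrite // mem_filter /= eqxx.
have -> : (\sum_(Q <- S) multiplicity Q f * multiplicity Q g =
    mult f * mult g +
    \sum_(Q <- S') multiplicity Q (strict_step d f) * multiplicity Q (strict_step d g))%N.
  rewrite (bigD1_seq [::]) //= big_map big_filter; congr (_ + _)%N.
  rewrite big_mkcond [RHS]big_mkcond; apply: eq_bigr => -[|d' Q] _ //=.
  (* Points in other directions contribute nothing, since an irreducible germ has a single tangent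
     direction. *)
  case: eqP => [[->]|dd']; first by rewrite !multiplicity_cons.
  rewrite !multiplicity_cons (multiplicity_unit _ (oth d' _)) // => E.
  by apply: dd'; rewrite E.
exact: (noether_step firr su isec).
Qed.

End Noether.

(** * Common points of two branches *)

Section Points.
Variable R : realType.
Local Notation C := (R[i]).
Local Notation germ := (germ R).
Implicit Types (f g h k q : germ) (d : direction R) (P Q T : ipoint R).

(** Transforms along a path of directions without base point, suited to concatenation and induction
    on the path. *)
Definition strict_along (s : seq (direction R)) f :=
  foldl (fun g d => strict_step d g) f s.
Definition pull_along (s : seq (direction R)) f :=
  foldl (fun g d => blowup d g) f s.

Lemma strict_cat P s f : strict P (P ++ s) f = strict_along s f.
Proof. by rewrite /strict drop_size_cat. Qed.
Lemma pullback_cat P s f : pullback P (P ++ s) f = pull_along s f.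
Proof. by rewrite /pullback drop_size_cat. Qed.
Lemma strict_nil P f : strict [::] P f = strict_along P f.
Proof. exact: strict_cat [::] P f. Qed.
Lemma pullback_nil P f : pullback [::] P f = pull_along P f.
Proof. exact: pullback_cat [::] P f. Qed.
Lemma multiplicityE P f : multiplicity P f = mult (strict_along P f).
Proof. by rewrite /multiplicity strict_nil. Qed.

Lemma strict_along_cat s t f : strict_along (s ++ t) f = strict_along t (strict_along s f).
Proof. exact: foldl_cat. Qed.
Lemma pull_along_cat s t f : pull_along (s ++ t) f = pull_along t (pull_along s f).
Proof. exact: foldl_cat. Qed.
Lemma exceptional_curve_cat P d s :
  exceptional_curve P (P ++ d :: s) = strict_along s (exceptional d).
Proof. by rewrite /exceptional_curve drop_size_cat // -cat_rcons strict_cat. Qed.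

Lemma sprefixP P Q : reflect (exists d s, Q = P ++ d :: s) (sprefix P Q).
Proof.
apply: (iffP andP) => [[/prefixP[[|d s] ->]]|[d [s ->]]].
- by rewrite cats0 eqxx.
- by exists d, s.
- split; first exact: prefix_prefix.
  by apply/eqP => /(congr1 size); rewrite size_cat /=; lia.
Qed.

Lemma sprefix_size P Q : sprefix P Q -> (size P < size Q)%N.
Proof. by case/sprefixP => d [s ->]; rewrite size_cat /=; lia. Qed.

Lemma sprefix_prefix P Q : sprefix P Q -> prefix P Q.
Proof. by case/andP. Qed.

Lemma prefix_sprefix_trans P Q T : prefix P Q -> sprefix Q T -> sprefix P T.
Proof.
move=> /prefixP[s ->] /sprefixP[d [t ->]]; apply/sprefixP; rewrite -catA.
by case: s => [|e s]; [exists d, t | exists e, (s ++ d :: t)].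
Qed.

Lemma sprefix_rcons P T d : sprefix P (rcons T d) -> prefix P T.
Proof.
case/sprefixP => e [s]; elim/last_ind: s => [|s a _].
  by rewrite -cat1s cats1 => /rcons_inj[-> _]; apply: prefix_refl.
by rewrite -rcons_cons -rcons_cat => /rcons_inj[-> _]; apply: prefix_prefix.
Qed.

Lemma sprefix_rconsT T d : sprefix T (rcons T d).
Proof. by apply/sprefixP; exists d, [::]; rewrite cats1. Qed.

Lemma strict_along_unit s f : f \is a GRing.unit -> strict_along s f \is a GRing.unit.
Proof. by move=> fu; rewrite -strict_nil; apply: strict_unit. Qed.

Lemma strict_along_neq0 s f : f != 0 -> strict_along s f != 0.
Proof. by elim: s f => [//|d s IH] f f0 /=; apply/IH/strict_step_neq0. Qed.

Lemma strict_alongM s f g : f != 0 -> g != 0 ->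
  strict_along s (f * g) = strict_along s f * strict_along s g.
Proof.
elim: s f g => [//|d s IH] f g f0 g0 /=.
by rewrite strict_stepM // IH ?strict_step_neq0.
Qed.

Lemma pull_alongM s f g : pull_along s (f * g) = pull_along s f * pull_along s g.
Proof. by elim: s f g => [//|d s IH] f g /=; rewrite blowupM IH. Qed.

Lemma pull_along_dvd s f g : germ_dvd f g -> germ_dvd (pull_along s f) (pull_along s g).
Proof. by case=> k ->; exists (pull_along s k); rewrite pull_alongM. Qed.

Lemma strict_dvd_pull s f : germ_dvd (strict_along s f) (pull_along s f).
Proof.
elim: s f => [|d s IH] f /=; first by exists 1; rewrite mul1r.
apply: germ_dvd_trans (IH _) _; apply/pull_along_dvd/dvd_strict_blowup.
Qed.

Lemma irreducible_along s f : germ_irreducible f ->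
  strict_along s f \isn't a GRing.unit -> germ_irreducible (strict_along s f).
Proof.
elim: s f => [//|d s IH] f firr /= su.
have du : strict_step d f \isn't a GRing.unit.
  by apply: contra su; apply: strict_along_unit.
by have [_ _ _ _ irr'] := irreducible_strict firr du; apply: IH.
Qed.

(** At each blowup, a germ whose pullback vanishes on the irreducible strict transform of [f] is a
    multiple of [f]. *)
Lemma dvd_descent s f g : germ_irreducible f ->
  strict_along s f \isn't a GRing.unit ->
  germ_dvd (strict_along s f) (strict_along s g) -> germ_dvd f g.
Proof.
elim: s f => [//|d s IH] f in g * => firr /= su fg.
have du : strict_step d f \isn't a GRing.unit.
  by apply: contra su; apply: strict_along_unit.
have [_ kf _ _ irr'] := irreducible_strict firr du; apply: kf.
exact: germ_dvd_trans (IH _ _ irr' su fg) (dvd_strict_blowup d g).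
Qed.

Lemma smooth_strict_Some0 c f : smooth f ->
  cf (strict_step (Some c) f) 0 0 = cf f 1 0 + cf f 0 1 * c.
Proof.
move=> sf; rewrite strict_step_Some0 smooth_mult // horner_poly.
by rewrite !big_ord_recl big_ord0 /= addr0 subn0 subnn expr0 mulr1 expr1.
Qed.

Lemma smooth_strict_None0 f : smooth f -> cf (strict_step None f) 0 0 = cf f 0 1.
Proof. by move=> sf; rewrite strict_step_None0 smooth_mult // coef_hform. Qed.

Lemma smooth_strict_step d f : smooth f -> strict_step d f \isn't a GRing.unit ->
  smooth (strict_step d f).
Proof.
have S (c : C) (g : germ) : smooth g -> strict_step (Some c) g \isn't a GRing.unit ->
    smooth (strict_step (Some c) g).
  move=> sg; rewrite germ_unitE negbK smooth_strict_Some0 // => /eqP g0.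
  split; first by rewrite smooth_strict_Some0.
  apply/orP; right; rewrite cf_strict_step_Some add0n smooth_mult //.
  (* The derivative of the strict transform along the exceptional curve is [cf g 0 1]; if it
     vanished, passing through the point would force [cf g 1 0 = 0] too. *)
  have -> : cf (blowup (Some c) g) 1 1 = cf g 0 1.
    rewrite /cf /= !big_ord_recl big_ord0 /= /bump /= bin0n mul0r mulr0.
    by rewrite add0r addr0 addn0 subnn binn expr0 !mulr1.
  case: sg => _; case: (eqVneq (cf g 0 1) 0) => [g01|//].
  by move: g0; rewrite g01 mul0r addr0 => ->; rewrite eqxx.
case: d => [c|] sf; first exact: S.
rewrite strict_step_None swap_unit => su; apply: smooth_swap; apply: S su.
exact: smooth_swap.
Qed.

Lemma smooth_along s f : smooth f -> strict_along s f \isn't a GRing.unit ->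
  smooth (strict_along s f).
Proof.
elim: s f => [//|d s IH] f sf /= su; apply: IH => //; apply: smooth_strict_step => //.
by apply: contra su; apply: strict_along_unit.
Qed.

Lemma smooth_tangent_uniq d d' f : smooth f ->
  strict_step d f \isn't a GRing.unit -> strict_step d' f \isn't a GRing.unit ->
  d = d'.
Proof.
move=> sf; have [_ f1] := sf; rewrite !germ_unitE !negbK.
case: d d' => [c|] [c'|]; rewrite ?smooth_strict_Some0 ?smooth_strict_None0 //.
- move=> /eqP fc /eqP fc'; congr Some; apply/eqP; rewrite -subr_eq0.
  have : cf f 0 1 * (c - c') == 0.
    have -> : cf f 0 1 * (c - c') =
      (cf f 1 0 + cf f 0 1 * c) - (cf f 1 0 + cf f 0 1 * c') by ring.
    by rewrite fc fc' subrr.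
  rewrite mulf_eq0 => /orP[/eqP f01|//]; move: f1 fc.
  by rewrite f01 mul0r addr0 eqxx orbF => /eqP.
- by move=> /eqP + /eqP f01; rewrite f01 mul0r addr0 => f10; move: f1; rewrite f01 f10 eqxx.
- by move=> /eqP f01 /eqP; rewrite f01 mul0r addr0 => f10; move: f1; rewrite f01 f10 eqxx.
Qed.

Lemma local_coordinates_smooth f g : local_coordinates f g -> smooth f /\ smooth g.
Proof.
rewrite /local_coordinates -!/(cf _ _ _) => -[f0 g0 fg]; split; split=> //; apply: contraNT fg;
  by rewrite negb_or !negbK => /andP[/eqP -> /eqP ->]; rewrite !(mul0r, mulr0) subrr.
Qed.

(** Two linear forms with nonzero determinant have no common root. *)
Lemma local_coordinates_tangent d f g : local_coordinates f g ->
  strict_step d f \isn't a GRing.unit -> strict_step d g \is a GRing.unit.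
Proof.
move=> fg; have [sf sg] := local_coordinates_smooth fg.
have [_ _] := fg; rewrite -!/(cf _ _ _) => det; rewrite !germ_unitE negbK => fd.
apply: contra det => gd; case: d fd gd => [c|].
  rewrite !smooth_strict_Some0 // !addr_eq0 => /eqP -> /eqP ->.
  by apply/eqP; ring.
by rewrite !smooth_strict_None0 // => /eqP -> /eqP ->; rewrite mul0r mulr0 subrr.
Qed.

Lemma smooth_dvd_assoc f g : smooth f -> smooth g -> germ_dvd f g -> germ_assoc f g.
Proof.
move=> sf sg [k gE]; exists k => //; have := smooth_mult sg.
have k0 : k != 0.
  by apply: contra (smooth_neq0 sg) => /eqP k0; rewrite gE k0 mul0r.
have f0 := smooth_neq0 sf; rewrite gE multM // (smooth_mult sf) addn1 => -[mk].
by apply/negPn; rewrite -mult_gt0_unit // mk.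
Qed.

Lemma smooth_irreducible f : smooth f -> germ_irreducible f.
Proof.
move=> sf; split; first exact: smooth_nonunit.
move=> g h fE; have f0 := smooth_neq0 sf.
have g0 : g != 0 by apply: contra f0 => /eqP g0; rewrite fE g0 mul0r.
have h0 : h != 0 by apply: contra f0 => /eqP h0; rewrite fE h0 mulr0.
have := smooth_mult sf; rewrite fE multM // => m1.
have [gu|gu] := boolP (g \is a GRing.unit); [by left|right].
apply/negPn; rewrite -mult_gt0_unit // -leqNgt leqn0; apply/eqP.
by move: gu; rewrite -mult_gt0_unit //; lia.
Qed.

Lemma irreducible_dvd_smooth_pow f a (k : nat) h : germ_irreducible f -> smooth a ->
  germ_dvd f (a ^+ k * h) -> germ_assoc a f \/ germ_dvd f h.
Proof.
move=> firr sa; elim: k => [|k IH]; first by rewrite mul1r; right.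
rewrite exprS -mulrA => -[t tE].
have [|[t' t'E]|af] := smooth_prime sa (g := t) (h := f).
- by rewrite -tE; exists (a ^+ k * h); rewrite mulrC.
- apply: IH; exists t'; apply: (germ_mulfI (smooth_neq0 sa)).
  by rewrite tE t'E; ring.
- by left; apply: irreducible_dvd_assoc => //; apply: smooth_nonunit.
Qed.

Lemma irreducible_dvd_crossing f a b u (k l : nat) : germ_irreducible f ->
  local_coordinates a b -> u \is a GRing.unit ->
  germ_dvd f (u * a ^+ k * b ^+ l) -> germ_assoc a f \/ germ_assoc b f.
Proof.
move=> firr /local_coordinates_smooth[sa sb] uu; rewrite mulrAC mulrC.
case/(irreducible_dvd_smooth_pow firr sa) => [|]; first by left.
rewrite mulrC; case/(irreducible_dvd_smooth_pow firr sb) => [|[t uE]]; first by right.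
by have [+ _] := firr; move: uu; rewrite uE unitrM => /andP[_ ->].
Qed.

(* At a point P where the total transform is a normal crossings divisor, the
   strict transforms of two distinct branches are the two coordinate curves,
   since by descent they are not equal; so they are separated by blowing up. *)
Lemma common_point_blown_up (B : {fset ipoint R}) fA fl fm Q :
  embedded_resolution B fA -> is_branch fl fA -> is_branch fm fA ->
  ~ germ_assoc fl fm ->
  (0 < multiplicity Q fl)%N -> (0 < multiplicity Q fm)%N ->
  forall P, sprefix P Q -> P \in B.
Proof.
move=> [cB resB] [irrl dl] [irrm dm] nlm.
have nonunit f : (0 < multiplicity Q f)%N -> strict_along Q f \isn't a GRing.unit.
  by rewrite multiplicityE; apply: contraTN => /mult_unit ->.
move=> /nonunit Ql /nonunit Qm.
(* Induction on the length of [P]: a shortest point missing from [B] is a point of the model, where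
   the normal crossings hypothesis applies. *)
suff H n P : (size P < n)%N -> sprefix P Q -> P \in B by move=> P; apply: (H (size P).+1).
elim: n P => // n IH P; rewrite ltnS => Pn PQ; apply/negPn/negP => PB.
have oP : on_model B P.
  split=> // T TP; apply: IH; first exact: leq_trans (sprefix_size TP) Pn.
  exact: prefix_sprefix_trans (sprefix_prefix TP) PQ.
have [a [b [ab [u [k [l [uu E]]]]]]] := resB P oP.
have [d [s QE]] := sprefixP _ _ PQ.
have tangent f : strict_along Q f \isn't a GRing.unit ->
    strict_step d (strict_along P f) \isn't a GRing.unit.
  by rewrite QE strict_along_cat /=; apply: contra; apply: strict_along_unit.
have nonunitP f : strict_along Q f \isn't a GRing.unit ->
    strict_along P f \isn't a GRing.unit.
  by move/tangent; apply: contra; apply: strict_step_unit.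
have coordinate f : germ_irreducible f -> germ_dvd f fA ->
    strict_along Q f \isn't a GRing.unit ->
    germ_assoc a (strict_along P f) \/ germ_assoc b (strict_along P f).
  move=> irrf df Qf; apply: (@irreducible_dvd_crossing _ a b u k l _ ab uu).
    by apply: irreducible_along => //; apply: nonunitP.
  rewrite -E pullback_nil; apply: germ_dvd_trans (strict_dvd_pull P f) _.
  exact: pull_along_dvd.
have [sa sb] := local_coordinates_smooth ab.
have transversal f g : germ_assoc a (strict_along P f) ->
    germ_assoc b (strict_along P g) -> strict_along Q f \isn't a GRing.unit ->
    strict_along Q g \isn't a GRing.unit -> False.
  move=> af bg /tangent + /tangent.
  rewrite (assoc_unit (assoc_strict_step d (smooth_neq0 sa) af)).
  rewrite (assoc_unit (assoc_strict_step d (smooth_neq0 sb) bg)).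
  by move=> /(local_coordinates_tangent ab) ->.
have same c : germ_assoc c (strict_along P fl) -> germ_assoc c (strict_along P fm) -> False.
  move=> cl cm; apply: nlm; apply: irreducible_dvd_assoc => //; last by case: irrl.
  apply: (dvd_descent irrl (nonunitP _ Ql)).
  exact: assoc_dvd (assoc_trans (assoc_sym cl) cm).
case: (coordinate _ irrl dl Ql) (coordinate _ irrm dm Qm) => cl [] cm.
- exact: same cl cm.
- exact: transversal cl cm Ql Qm.
- exact: transversal cm cl Qm Ql.
- exact: same cl cm.
Qed.

(** The intermediate model required by [adapted] blows up exactly the strict prefixes of [Q], which
    lie in [B] by separation of the branches. *)
Lemma common_point_mem (X : cross_constellation R) fA fl fm Q :
  fA != 0 -> adapted X fA -> is_branch fl fA -> is_branch fm fA ->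
  ~ germ_assoc fl fm ->
  (0 < multiplicity Q fl)%N -> (0 < multiplicity Q fm)%N -> Q \in points X.
Proof.
move=> fA0 [[B resB XP] _] bl bm nlm Ql Qm; apply/XP.
have QB := common_point_blown_up resB bl bm nlm Ql Qm; split.
  have [k fAE] := bl.2; rewrite multiplicityE mult_gt0_unit ?strict_along_neq0 //.
  have k0 : k != 0 by apply: contra fA0 => /eqP k0; rewrite fAE k0 mul0r.
  rewrite fAE strict_alongM ?(irreducible_neq0 bl.1) // unitrM negb_and; apply/orP; right.
  by move: Ql; rewrite multiplicityE; apply: contraTN => /mult_unit ->.
exists [fset P in B | sprefix P Q]%fset; split.
- move=> P T PT; rewrite !inE /= => /andP[TB TQ]; apply/andP; split.
    by apply: resB.1 PT TB.
  exact: prefix_sprefix_trans PT TQ.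
- by move=> P; rewrite !inE => /andP[].
- split=> [P PQ|]; first by rewrite !inE /= PQ andbT; apply: QB.
  by rewrite !inE /= /sprefix eqxx !andbF.
Qed.

Lemma intersection_numberP f g n : codim (@all_germs R) (ideal2 f g) n ->
  intersection_number f g n.
Proof.
move=> [e [_ ie se]]; exists e => h; have [c [u [v E]]] := se h I.
exists [ffun i => c i]; split.
  exists u, v; rewrite -E; under eq_bigr => i _ do rewrite ffunE -germ_scaleE.
  by rewrite addrC subrK.
move=> c' [u' [v' hE]]; apply/ffunP => i; rewrite ffunE; apply/eqP; rewrite -subr_eq0.
apply/eqP; apply: (ie (fun i => c i - c' i)); exists (u' - u), (v' - v).
under eq_bigr => j _ do rewrite scalerBl.
rewrite sumrB; move: E; rewrite {1}hE.
set s := \sum_i c i *: e i; set s' := \sum_i c' i *: e i => E.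
have -> : s = s' + (u' * f + v' * g) - (u * f + v * g) by rewrite -E; ring.
by ring.
Qed.

End Points.

(** * Edges of the lotus *)

Section Lotus.
Variables (R : realType) (X : cross_constellation R).
Local Notation C := (R[i]).
Local Notation germ := (germ R).
Implicit Types (f g h k : germ) (d : direction R) (P Q T : ipoint R).

Lemma smooth_dvd_exp f g n : smooth f -> germ_dvd f (g ^+ n) -> germ_dvd f g.
Proof.
move=> sf; elim: n => [[k E]|n IH]; last by rewrite exprS => /(smooth_prime sf)[].
have := smooth_nonunit sf; suff -> : f \is a GRing.unit by [].
by apply/unitrPr; exists k; rewrite mulrC -E.
Qed.

Lemma pull_alongX s f n : pull_along s (f ^+ n) = pull_along s f ^+ n.
Proof.
elim: n => [|n IH]; last by rewrite !exprS pull_alongM IH.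
by elim: s => [//|d s IH]; rewrite /= blowup1.
Qed.

(** The total transform of a smooth curve consists of its strict transform and of exceptional
    curves. The unit case covers a curve that has left the path. *)
Lemma smooth_dvd_pull s f g : smooth g -> smooth f \/ f \is a GRing.unit ->
  germ_dvd g (pull_along s f) ->
  germ_assoc (strict_along s f) g \/
  exists s1 d s2, s = s1 ++ d :: s2 /\ germ_assoc (strict_along s2 (exceptional d)) g.
Proof.
move=> sg; elim: s f => [|d s IH] f sf gf.
  left; case: sf => [sf|fu]; first exact/assoc_sym/smooth_dvd_assoc.
  by have := smooth_nonunit sg; case: gf fu => k /= ->; rewrite unitrM => /andP[_ ->].
move: gf; rewrite /= strict_stepP pull_alongM pull_alongX.
case/(smooth_prime sg) => [/(smooth_dvd_exp sg) gE|gs].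
  case: (IH (exceptional d) (or_introl (smooth_exceptional d)) gE) => [ag|].
    by right; exists [::], d, s.
  by move=> [s1 [e [s2 [-> ag]]]]; right; exists (d :: s1), e, s2.
have sf' : smooth (strict_step d f) \/ strict_step d f \is a GRing.unit.
  have [fu|fu] := boolP (strict_step d f \is a GRing.unit); [by right|left].
  case: sf => [sf|/(strict_step_unit d)]; last by rewrite (negPf fu).
  exact: smooth_strict_step.
case: (IH _ sf' gs) => [ag|]; first by left.
by move=> [s1 [e [s2 [-> ag]]]]; right; exists (d :: s1), e, s2.
Qed.

Lemma smooth_branch P b : P \in points X -> smooth (branch X P b).
Proof. by move=> PX; have [] := local_coordinates_smooth (branch_cross PX); case: b. Qed.

(** A branch that is not new at [Q] is traced back to the shortest point [T] whose cross contains it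
    in its total transform: there it is an exceptional curve, or a branch of [X_T], new by
    minimality. *)
Lemma label_exists Q b : Q \in points X -> exists l, has_label X Q b l.
Proof.
move=> QX; pose bad n := `[< exists T, [/\ T \in points X, sprefix T Q, size T = n &
  germ_dvd (branch X Q b) (pullback T Q (cross X T))] >].
have [nb|nb] := pselect (new_branch X Q b).
  exists (New Q b); split=> //; first exact: prefix_refl.
  exists 1; first exact: unitr1.
  by rewrite /strict drop_size mul1r.
have bad_ex : exists n, bad n.
  apply: contrapT => nbad; apply: nb => T TX TQ bT; apply: nbad.
  by exists (size T); apply/asboolP; exists T.
case: (ex_minnP bad_ex) => n /asboolP[T [TX TQ sT bT]] nmin.
have [d [s QE]] := sprefixP _ _ TQ; set t := d :: s in QE.
have sQ := smooth_branch b QX.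
have [c bTc] : exists c, germ_dvd (branch X Q b) (pull_along t (branch X T c)).
  move: bT; rewrite {2}QE pullback_cat /cross pull_alongM.
  by case/(smooth_prime sQ) => ?; [exists false | exists true].
case: (smooth_dvd_pull sQ (or_introl (smooth_branch c TX)) bTc) => [ab|].
  exists (New T c); split=> //; first exact: sprefix_prefix.
    move=> T' T'X T'T cT'; have : bad (size T').
      apply/asboolP; exists T'; split=> //.
        exact: prefix_sprefix_trans (sprefix_prefix T'T) TQ.
      apply: germ_dvd_trans bTc _; case/sprefixP: (T'T) => e [r TE].
      have -> : pullback T' Q (cross X T') =
          pull_along t (pull_along (e :: r) (cross X T')).
        by rewrite QE TE -catA pullback_cat -pull_along_cat.
      by apply: pull_along_dvd; move: cT'; rewrite {2}TE pullback_cat.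
    by move/nmin; rewrite -sT leqNgt (sprefix_size T'T).
  by rewrite {1}QE strict_cat.
move=> [s1 [e [s2 [tE ag]]]]; exists (Exc (T ++ s1)).
have QE' : Q = (T ++ s1) ++ e :: s2 by rewrite QE tE catA.
split; first by apply/sprefixP; exists e, s2.
by rewrite {1}QE' exceptional_curve_cat.
Qed.

(** The branches of [X_T] pass through [T], so the total transform of [X_T] contains E_T, and
    [branch_total] puts E_T into the next cross. *)
Lemma exc_dual_segment T d : rcons T d \in points X ->
  dual_segment X (rcons T d) (Exc T).
Proof.
move=> PX; have TP := sprefix_rconsT T d.
have TX := points_constellation (sprefix_prefix TP) PX.
have EE : pullback T (rcons T d) = blowup d.
  by apply: funext => f; rewrite -cats1 pullback_cat.
have Exc_le : germ_dvd (exceptional d) (cross X (rcons T d)).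
  have := branch_total TX PX (sprefix_prefix TP); rewrite EE; apply.
    exact/smooth_irreducible/smooth_exceptional.
  rewrite blowupM; apply: germ_dvdM.
  rewrite strict_stepP (smooth_mult (smooth_branch _ TX)) expr1 mulrC.
  by exists (strict_step d (branch X T true)).
have [b Eb] : exists b, germ_dvd (exceptional d) (branch X (rcons T d) b).
  case: (smooth_prime (smooth_exceptional d) Exc_le) => ?; by [exists false | exists true].
exists b; split=> //; rewrite -{1}cats1 exceptional_curve_cat /=.
exact: smooth_dvd_assoc (smooth_exceptional d) (smooth_branch b PX) Eb.
Qed.

Lemma branch_not_assoc P b : P \in points X ->
  ~ germ_assoc (branch X P b) (branch X P (~~ b)).
Proof.
move=> PX; have lc := branch_cross PX.
have [s0 s1] := local_coordinates_smooth lc.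
suff H : ~ germ_assoc (branch X P false) (branch X P true).
  by case: b => [/assoc_sym|].
move=> a01; have [d du] := direction_exists (smooth_neq0 s0) (smooth_nonunit s0).
have := assoc_strict_step d (smooth_neq0 s0) a01 => /assoc_unit.
by rewrite (local_coordinates_tangent lc du) (negPf du).
Qed.

Lemma label_nonunit f Q b : Q \in points X -> germ_assoc f (branch X Q b) ->
  f \isn't a GRing.unit.
Proof. by move=> QX /assoc_unit <-; apply/smooth_nonunit/smooth_branch. Qed.

(** Unless it is born at [rcons T d], such a label names a smooth curve through [T], which has only
    one tangent direction. *)
Lemma other_label T d d' l : rcons T d \in points X -> rcons T d' \in points X ->
  l <> Exc T -> dual_segment X (rcons T d) l -> dual_segment X (rcons T d') l ->
  d = d'.
Proof.
move=> PX P'X lT [b Pl] [b' P'l]; have TP := sprefix_rconsT T d.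
have passes f s : smooth f \/ f \is a GRing.unit ->
    strict_along (rcons s d) f \isn't a GRing.unit ->
    strict_along (rcons s d') f \isn't a GRing.unit -> d = d'.
  rewrite -!cats1 !strict_along_cat /= => sf fd fd'.
  have fs : strict_along s f \isn't a GRing.unit.
    by apply: contra fd; apply: strict_step_unit.
  apply: smooth_tangent_uniq fd fd'; apply: smooth_along => //.
  by case: sf => // fu; have := strict_along_unit s fu; rewrite (negPf fs).
case: l lT Pl P'l => [S lT|S c lT].
  move=> [SP aP] [SP' aP']; have /sprefixP[e [s TE]] : sprefix S T.
    apply/andP; split; first exact: sprefix_rcons SP.
    by apply/eqP => ST; apply: lT; rewrite ST.
  have uP := label_nonunit PX aP; have uP' := label_nonunit P'X aP'.
  move: uP uP'; rewrite !TE !rcons_cat /= !exceptional_curve_cat.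
  by apply: passes; left; apply: smooth_exceptional.
move=> [SX SP _ aP] [_ SP' _ aP'].
have uP := label_nonunit PX aP; have uP' := label_nonunit P'X aP'.
(* A label born at [rcons T d] makes this point a prefix of [rcons T d'], which has the same
   length. *)
have [SE|SE] := eqVneq S (rcons T d).
  move: SP'; rewrite SE => /prefixP[[|a s]].
    by rewrite cats0 => /rcons_inj[].
  by move=> /(congr1 size); rewrite size_cat !size_rcons /=; lia.
have /prefixP[s TE] : prefix S T by apply: (@sprefix_rcons _ _ _ d); rewrite /sprefix SP SE.
move: uP uP'; rewrite !TE !rcons_cat !strict_cat.
by apply: passes; left; apply: smooth_branch.
Qed.

(** The vertices [Exc T] and [Exc T'] lie on both segments, so [T] and [T'] are prefixes of each
    other; the second vertex then fixes the direction. *)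
Lemma dual_segment_inj P Q : P \in points X -> Q \in points X ->
  dual_segment X P = dual_segment X Q -> P = Q.
Proof.
have parent T d Q' : rcons T d \in points X ->
    dual_segment X (rcons T d) = dual_segment X Q' -> sprefix T Q'.
  by move=> PX E; have := exc_dual_segment PX; rewrite E => -[b []].
case: (lastP P) (lastP Q) => [|T d] [|T' d'] PX QX E //.
- by have /sprefixP[? [?]] := parent _ _ _ QX (esym E); case: T' {QX E}.
- by have /sprefixP[? [?]] := parent _ _ _ PX E; case: T {PX E}.
have TT' : T = T'.
  have /sprefix_rcons/prefixP[s sE] := parent _ _ _ PX E.
  have /sprefix_rcons/prefixP[s' s'E] := parent _ _ _ QX (esym E).
  have : size s = 0%N.
    by have := congr1 size sE; have := congr1 size s'E; rewrite !size_cat; lia.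
  by move/size0nil => s0; rewrite sE s0 cats0.
rewrite -TT' in QX E *; congr rcons.
have [b [_ Eb]] := exc_dual_segment PX.
have [l lb] := label_exists (~~ b) PX.
apply: (other_label (l := l) PX QX); first 1 last.
- by exists (~~ b).
- by rewrite -E; exists (~~ b).
move=> lE; move: lb; rewrite lE => -[_ Eb'].
exact: branch_not_assoc PX (assoc_trans (assoc_sym Eb) Eb').
Qed.

Lemma dual_edgesE :
  dual_edges X = [set dual_segment X P | P in [set` points X]]%classic.
Proof.
apply/seteqP; split=> [s [] //|_ [P PX <-]]; split; last by exists P.
split; last by left; exists P.
by have [l lP] := label_exists false PX; exists l, false.
Qed.

(** Injectivity of [dual_segment] makes the value on an edge well defined; other sets receive the
    default 0. *)
Lemma decorates_exists f : exists m, decorates X m f.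
Proof.
pose m s := if pselect (exists2 P, P \in points X & dual_segment X P = s) is left h
  then multiplicity (projT1 (cid2 h)) f else 0%N.
exists m => P PX; rewrite /m; case: pselect => [h|[]]; last by exists P.
by case: cid2 => Q QX /= /(dual_segment_inj QX PX) ->.
Qed.

End Lotus.

Theorem corollary9p3 (R : realType) (fA : germ R) (X : cross_constellation R)
    (fl fm : germ R) :
  reduced_curve fA -> adapted X fA ->
  is_branch fl fA -> is_branch fm fA -> ~ germ_assoc fl fm ->
  exists ml mm : set (label R) -> nat,
    [/\ decorates X ml fl,
        decorates X mm fm,
        intersection_number fl fm
          (\big[addn/0%N]_(s \in dual_edges X) (ml s * mm s)%N) &
        intersection_number fl fm
          (\sum_(P <- points X) multiplicity P fl * multiplicity P fm)%N].
Proof.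
move=> [fA0 _ _] adX bl bm nlm.
have [ml mlP] := decorates_exists X fl; have [mm mmP] := decorates_exists X fm.
have noether : intersection_number fl fm
    (\sum_(P <- points X) multiplicity P fl * multiplicity P fm)%N.
  apply: intersection_numberP.
  pose N := (\max_(P <- points X) size P).+1%N.
  have [] // := @noether_sum R N (points X) fl fm bl.1 (irreducible_neq0 bm.1) (fset_uniq _).
  move=> Q Ql Qm; have QX := common_point_mem fA0 adX bl bm nlm Ql Qm.
  by split=> //; rewrite ltnS; apply: (leq_bigmax_seq (F := size)).
exists ml, mm; split=> //.
(* The sum over edges is reindexed by points, as distinct points have distinct dual segments. *)
rewrite dual_edgesE fsbig_image; last first.
  by move=> P Q; rewrite !inE => PX QX; apply: dual_segment_inj.
rewrite -fsbig_seq ?fset_uniq //=.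
suff -> : (\sum_(P <- points X) ml (dual_segment X P) * mm (dual_segment X P) =
   \sum_(P <- points X) multiplicity P fl * multiplicity P fm)%N by [].
by apply: eq_big_seq => P PX; rewrite mlP // mmP.
Qed.
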